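(* Let $Y$ be a 7-manifold with a torsion-free $G_2$ structure $\varphi$ (with metric $k$) and a nowhere vanishing infinitesimal isometry $V$ with orbit space $N$, and suppose that the induced almost-Kähler structure $(h,\sigma,J)$ on $N$ is Kähler (i.e. $J$ is integrable). Let $t=k(V,V)^{-1/2}$, regarded as a function on $N$, and let $U$ be the Hamiltonian vector field on $(N,\sigma)$ corresponding to $-t$, i.e. $\imath_U\sigma=-dt$. Then the horizontal lift of $U$ to $(Y,k)$ is an infinitesimal isometry of the $G_2$ structure $\varphi$, which commutes with $V$.
   Context: A torsion-free $G_2$ structure on a 7-manifold $Y$ is an admissible 3-form $\varphi$ (at each point linearly equivalent to $(e^{12}+e^{34}+e^{56})\wedge e^7+\mathrm{Re}\big((e^1+ie^2)\wedge(e^3+ie^4)\wedge(e^5+ie^6)\big)$ with $(e^i)$ an orthonormal oriented coframe, which determines a Riemannian metric $k$, an orientation and a Hodge operator $*$) with $d\varphi=0$ and $d{*\varphi}=0$. An infinitesimal isometry of it is a vector field $X$ with $\mathcal L_X\varphi=0$. Considerations are local, so that the orbit space $N$ of $V$ is a smooth 6-manifold. Induced structure on $N$: $t=k(V,V)^{-1/2}$, $\eta=k(\cdot,t^2V)$, $k=\check k+t^{-2}\eta\otimes\eta$ with $\check k$ the quotient metric on $N$; $\sigma=\imath_V\varphi$ (descends to a symplectic form); $h=t^{-1}\check k$; $J$ is the almost-complex structure with $h(J\cdot,\cdot)=\sigma(\cdot,\cdot)$. The horizontal lift of a vector field on $N$ is its unique lift to $Y$ that is $k$-orthogonal to $V$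 (equivalently, annihilated by $\eta$). *)

(* Defs.v *)
From HB Require Import structures.
From mathcomp Require Import all_boot all_order all_algebra.
From mathcomp Require Import all_classical all_reals.
From mathcomp Require Import topology normedtype derive.

Set Implicit Arguments.
Unset Strict Implicit.
Unset Printing Implicit Defensive.

Import Order.TTheory GRing.Theory Num.Theory numFieldNormedType.Exports.
Local Open Scope classical_set_scope.
Local Open Scope ring_scope.

(* Vectors are row vectors. A k-tuple of vectors of R^n is the k x n matrix
   whose rows are these vectors, and a linear map acts on it by right
   multiplication; [jacobian f x] follows the same convention. *)

Fixpoint Ck_on (R : realType) (n : nat) (W : normedModType R) (k : nat)
    (U : set 'rV[R]_n) (f : 'rV[R]_n -> W) : Prop :=
  if k is k'.+1 then
    (forall x, U x -> differentiable f x) /\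
    (forall v : 'rV[R]_n, Ck_on k' U (fun x => 'D_v f x))
  else forall x, U x -> {for x, continuous f}.

Definition smooth_on (R : realType) (n : nat) (W : normedModType R)
    (U : set 'rV[R]_n) (f : 'rV[R]_n -> W) : Prop :=
  forall k, Ck_on k U f.

(* [param i] is the inverse of [chart i]; both are total functions whose values
   outside [dom i], resp. [chart i @` dom i], are irrelevant. *)
Record manifold (R : realType) (n : nat) := Manifold {
  carrier :> topologicalType;
  idx : Type;
  dom : idx -> set carrier;
  chart : idx -> carrier -> 'rV[R]_n;
  param : idx -> 'rV[R]_n -> carrier;
  manifold_hausdorff : hausdorff_space carrier;
  manifold_countable : @second_countable carrier;
  dom_cover : forall p, exists i, dom i p;
  dom_open : forall i, open (dom i);
  cod_open : forall i, open (chart i @` dom i);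
  chartK : forall i p, dom i p -> param i (chart i p) = p;
  chart_continuous : forall i p, dom i p -> {for p, continuous (chart i)};
  param_continuous : forall i x, (chart i @` dom i) x ->
    {for x, continuous (param i)};
  transition_smooth : forall i j,
    smooth_on (chart i @` dom i `&` param i @^-1` dom j)
              (fun x => chart j (param i x))
}.

Definition cod (R : realType) (n : nat) (M : manifold R n) (i : idx M) :
    set 'rV[R]_n := chart i @` dom i.

Section Maps.
Variables (R : realType) (m n : nat) (M : manifold R m) (N : manifold R n).

Definition loc (f : M -> N) (i : idx M) (j : idx N) : 'rV[R]_m -> 'rV[R]_n :=
  fun x => chart j (f (param i x)).

Definition loc_dom (f : M -> N) (i : idx M) (j : idx N) : set 'rV[R]_m :=
  cod i `&` (fun x => dom j (f (param i x))).

Definition smooth_map (f : M -> N) : Prop :=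
  continuous f /\ forall i j, smooth_on (loc_dom f i j) (loc f i j).

Definition submersion (f : M -> N) : Prop :=
  forall i j x, loc_dom f i j x -> row_full (jacobian (loc f i j) x).

End Maps.

(* A tensor field is given by its components in every chart, with the
   transformation law under the changes of coordinates [loc id i j]. *)
Section Fields.
Variables (R : realType) (n : nat) (M : manifold R n).

Definition smooth_fun (f : M -> R) : Prop :=
  forall i, smooth_on (cod i) (fun x => f (param i x)).

Record vfield := VField {
  vcomp :> idx M -> 'rV[R]_n -> 'rV[R]_n;
  vfield_smooth : forall i, smooth_on (cod i) (vcomp i);
  vfield_transform : forall i j x, loc_dom (id : M -> M) i j x ->
    vcomp j (loc (id : M -> M) i j x)
      = vcomp i x *m jacobian (loc (id : M -> M) i j) x
}.

Record endofield := EndoField {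
  ecomp :> idx M -> 'rV[R]_n -> 'M[R]_n;
  endofield_smooth : forall i, smooth_on (cod i) (ecomp i);
  endofield_transform : forall i j x, loc_dom (id : M -> M) i j x ->
    jacobian (loc (id : M -> M) i j) x *m ecomp j (loc (id : M -> M) i j x)
      = ecomp i x *m jacobian (loc (id : M -> M) i j) x
}.

Definition multilinear (k : nat) (f : 'M[R]_(k, n) -> R) : Prop :=
  forall (r : 'I_k) (A B C : 'M[R]_(k, n)) (b c : R),
    row r A = b *: row r B + c *: row r C ->
    row' r A = row' r B -> row' r A = row' r C ->
    f A = b * f B + c * f C.

Definition alternating (k : nat) (f : 'M[R]_(k, n) -> R) : Prop :=
  forall (r s : 'I_k) (A : 'M[R]_(k, n)), r != s -> row r A = row s A -> f A = 0.

Record tensor (k : nat) := Tensor {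
  tcomp :> idx M -> 'rV[R]_n -> 'M[R]_(k, n) -> R;
  tensor_multilinear : forall i x, cod i x -> multilinear (tcomp i x);
  tensor_smooth : forall i A, smooth_on (cod i) (fun x => tcomp i x A);
  tensor_transform : forall i j x A, loc_dom (id : M -> M) i j x ->
    tcomp i x A
      = tcomp j (loc (id : M -> M) i j x) (A *m jacobian (loc (id : M -> M) i j) x)
}.

Record dform (k : nat) := DForm {
  dform_tensor :> tensor k;
  dform_alternating : forall i x, cod i x -> alternating (dform_tensor i x)
}.

End Fields.

Section LocalCalculus.
Variables (R : realType) (n : nat).

Definition bracket (X Y : 'rV[R]_n -> 'rV[R]_n) (x : 'rV[R]_n) : 'rV[R]_n :=
  'D_(X x) Y x - 'D_(Y x) X x.

(* Invariant formula for d on constant vector fields, whose brackets vanish. *)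
Definition ext_d (k : nat) (w : 'rV[R]_n -> 'M[R]_(k, n) -> R)
    (x : 'rV[R]_n) (A : 'M[R]_(k.+1, n)) : R :=
  \sum_(r < k.+1) (-1) ^+ r * 'D_(row r A) (fun y => w y (row' r A)) x.

Definition set_row (k : nat) (r : 'I_k) (u : 'rV[R]_n) (A : 'M[R]_(k, n)) :
    'M[R]_(k, n) :=
  \matrix_(s, c) if s == r then u 0 c else A s c.

(* (L_X w)(v_1, .., v_k) = X (w(v_1, .., v_k)) - sum_r w(.., [X, v_r], ..) for
   constant fields v_r, for which [X, v_r] = - D_(v_r) X. *)
Definition lie_deriv (k : nat) (X : 'rV[R]_n -> 'rV[R]_n)
    (w : 'rV[R]_n -> 'M[R]_(k, n) -> R) (x : 'rV[R]_n) (A : 'M[R]_(k, n)) : R :=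
  'D_(X x) (fun y => w y A) x
  + \sum_(r < k) w x (set_row r ('D_(row r A) X x) A).

(* The Nijenhuis tensor is tensorial, so constant fields u, v suffice:
   [Ju, Jv] - J[Ju, v] - J[u, Jv] - [u, v]. *)
Definition nijenhuis (J : 'rV[R]_n -> 'M[R]_n) (x u v : 'rV[R]_n) : 'rV[R]_n :=
  let Ju := fun y => u *m J y in
  let Jv := fun y => v *m J y in
  bracket Ju Jv x - bracket Ju (cst v) x *m J x
  - bracket (cst u) Jv x *m J x - bracket (cst u) (cst v) x.

End LocalCalculus.

Section Calculus.
Variables (R : realType) (n : nat) (M : manifold R n).

Definition closed_form (k : nat) (w : dform M k) : Prop :=
  forall i x A, cod i x -> ext_d (w i) x A = 0.

Definition preserves (k : nat) (X : vfield M) (w : dform M k) : Prop :=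
  forall i x A, cod i x -> lie_deriv (X i) (w i) x A = 0.

Definition commuting (X Y : vfield M) : Prop :=
  forall i x, cod i x -> bracket (X i) (Y i) x = 0.

Definition nowhere_vanishing (X : vfield M) : Prop :=
  forall i x, cod i x -> X i x != 0.

Definition integrable_acs (J : endofield M) : Prop :=
  forall i x u v, cod i x -> nijenhuis (J i) x u v = 0.

(* X is the Hamiltonian vector field of f, with the sign convention i_X w = df. *)
Definition hamiltonian (w : dform M 2) (f : M -> R) (X : vfield M) : Prop :=
  forall i x (v : 'rV[R]_n), cod i x ->
    w i x (col_mx (X i x) v) = 'D_v (fun y => f (param i y)) x.

Definition integral_curve (X : vfield M) (c : R -> M) (a b : R) : Prop :=
  forall s, a < s < b -> {for s, continuous c} /\
    forall i, dom i (c s) ->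
      is_derive s 1 (fun r => chart i (c r)) (X i (chart i (c s))).

Definition same_orbit (X : vfield M) (p q : M) : Prop :=
  exists (c : R -> M) (a b s r : R),
    [/\ integral_curve X c a b, a < s < b, a < r < b, c s = p & c r = q].

End Calculus.

(* Coframes of R^n: an invertible matrix E stands for the coframe e^1, .., e^n
   with e^a(v) = (v *m E)_a; the rows of [invmx E] are the dual frame. *)
Section Coframes.
Variable R : realType.

(* e^{s_1} /\ .. /\ e^{s_k} for the standard coframe, with 1-based indices. *)
Definition ewedge (n : nat) (s : seq nat) (k : nat) (A : 'M[R]_(k, n.+1)) : R :=
  \det (\matrix_(a < k, b < k) A a (inord (nth 1%N s b).-1)).

(* (e^12 + e^34 + e^56) /\ e^7 + Re ((e^1 + ie^2)(e^3 + ie^4)(e^5 + ie^6)). *)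
Definition phi0 (A : 'M[R]_(3, 7)) : R :=
  ewedge [:: 1; 2; 7]%N A + ewedge [:: 3; 4; 7]%N A + ewedge [:: 5; 6; 7]%N A
  + (ewedge [:: 1; 3; 5]%N A - ewedge [:: 1; 4; 6]%N A
     - ewedge [:: 2; 3; 6]%N A - ewedge [:: 2; 4; 5]%N A).

Definition coframe_metric (n : nat) (E : 'M[R]_n) (A : 'M[R]_(2, n)) : R :=
  ((row 0 A *m E) *m (row 1 A *m E)^T) 0 0.

(* Hodge operator for which E is an orthonormal oriented coframe: contraction
   of the form with the volume form e^1 /\ .. /\ e^n,
   ( *w)(B) = 1/k! sum_s w(f_s) vol(f_s, B), f the dual frame. *)
Definition coframe_hodge (k m : nat) (E : 'M[R]_(k + m))
    (w : 'M[R]_(k, k + m) -> R) (B : 'M[R]_(m, k + m)) : R :=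
  (k`!%:R)^-1 * \sum_(s : {ffun 'I_k -> 'I_(k + m)})
    w (rowsub s (invmx E)) * \det (col_mx (rowsub s (invmx E)) B *m E).

End Coframes.

Section G2.
Variables (R : realType) (Y : manifold R 7).

Definition adapted_coframe (phi : dform Y 3) (i : idx Y) (x : 'rV[R]_7)
    (E : 'M[R]_7) : Prop :=
  E \in unitmx /\ forall A : 'M[R]_(3, 7), phi i x A = phi0 (A *m E).

Definition admissible (phi : dform Y 3) : Prop :=
  forall i x, cod i x -> exists E, adapted_coframe phi i x E.

Definition is_g2_metric (phi : dform Y 3) (k : tensor Y 2) : Prop :=
  forall i x E A, cod i x -> adapted_coframe phi i x E ->
    k i x A = coframe_metric E A.

Definition is_g2_hodge_dual (phi : dform Y 3) (psi : dform Y 4) : Prop :=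
  forall i x E (B : 'M[R]_(4, 7)), cod i x -> adapted_coframe phi i x E ->
    psi i x B = @coframe_hodge R 3 4 E (phi i x) B.

Definition torsion_free_g2 (phi : dform Y 3) : Prop :=
  [/\ admissible phi, closed_form phi &
      exists2 psi : dform Y 4, is_g2_hodge_dual phi psi & closed_form psi].

End G2.

Section Reduction.
Variables (R : realType) (Y : manifold R 7) (N : manifold R 6).
Variables (V : vfield Y) (pr : Y -> N) (k : tensor Y 2).

(* pr : Y -> N exhibits N as the orbit space: the fibres are tangent to V, hence
   unions of orbits, and each of them is a single orbit. *)
Definition is_orbit_space : Prop :=
  [/\ smooth_map pr, submersion pr, (forall q, exists p, pr p = q),
      (forall i j x, loc_dom pr i j x -> V i x *m jacobian (loc pr i j) x = 0)
    & (forall p q, pr p = pr q -> same_orbit V p q)].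

Definition tY (i : idx Y) (x : 'rV[R]_7) : R :=
  (Num.sqrt (k i x (col_mx (V i x) (V i x))))^-1.

Definition eta (i : idx Y) (x v : 'rV[R]_7) : R :=
  k i x (col_mx v (tY i x ^+ 2 *: V i x)).

Definition descends_t (t : N -> R) : Prop :=
  smooth_fun t /\ forall i x, cod i x -> t (pr (param i x)) = tY i x.

Definition is_quotient_metric (kN : tensor N 2) : Prop :=
  forall i j x (u v : 'rV[R]_7), loc_dom pr i j x ->
    k i x (col_mx u v)
      = kN j (loc pr i j x) (col_mx u v *m jacobian (loc pr i j) x)
        + (tY i x) ^- 2 * (eta i x u * eta i x v).

Definition descends_sigma (phi : dform Y 3) (sigma : dform N 2) : Prop :=
  forall i j x (B : 'M[R]_(2, 7)), loc_dom pr i j x ->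
    phi i x (col_mx (V i x) B)
      = sigma j (loc pr i j x) (B *m jacobian (loc pr i j) x).

Definition hN (t : N -> R) (kN : tensor N 2) (j : idx N) (y : 'rV[R]_6)
    (A : 'M[R]_(2, 6)) : R :=
  (t (param j y))^-1 * kN j y A.

Definition is_induced_acs (t : N -> R) (kN : tensor N 2) (sigma : dform N 2)
    (J : endofield N) : Prop :=
  forall j y (u v : 'rV[R]_6), cod j y ->
    hN t kN j y (col_mx (u *m J j y) v) = sigma j y (col_mx u v).

Definition is_horizontal_lift (U : vfield N) (X : vfield Y) : Prop :=
  (forall i j x, loc_dom pr i j x ->
     X i x *m jacobian (loc pr i j) x = U j (loc pr i j x)) /\
  (forall i x, cod i x -> eta i x (X i x) = 0).

End Reduction.

(* Main.v *)
(** With [sigma = i_V phi], [eta = k(., t^2 V)] and [chi = phi - sigma /\ eta], the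
    form [chi] is of type (3,0)+(0,3) for [J], and contracting [*phi] with [V]
    gives the imaginary counterpart of [chi / t].  As [sigma], [J], [h] descend
    to [N], so does [eta], whence [L_V *phi = 0] and [i_V *phi] is closed; since
    [J] is integrable, [chi / t] is then closed as well.  Now [d phi = 0] reads
    [sigma /\ d eta = - d chi = - dt /\ chi / t], while contracting
    [sigma /\ chi = 0] with the lift [X] of [U] yields
    [sigma /\ i_X chi = dt /\ chi], so that [d eta = - i_X chi / t] by injectivity
    of [sigma /\ .] on 2-forms.  Hence [i_X phi = - dt /\ eta - t d eta = - d (t eta)]
    and [L_X phi = d (i_X phi) = 0]. *)

Require Import Defs.
From HB Require Import structures.
From mathcomp Require Import all_boot all_order all_algebra.
From mathcomp Require Import all_classical all_reals.
From mathcomp Require Import topology normedtype derive landau.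
From mathcomp Require Import perm ring lra.

Set Implicit Arguments.
Unset Strict Implicit.
Unset Printing Implicit Defensive.

Import Order.TTheory GRing.Theory Num.Theory numFieldNormedType.Exports.
Local Open Scope classical_set_scope.
Local Open Scope ring_scope.

(** * Tuples of vectors and the cross product of [phi0] *)

(** Adapted coframes exist point by point only, with no regularity in the point, so nothing is
    differentiated in a coframe. They serve to establish pointwise identities between [phi], [*phi],
    [k] and the cross product, and it is these identities that are differentiated. Flows do not
    occur: the geometry at a point becomes algebra of first-order jets, second derivatives entering
    only through their symmetry. Forms are not complexified either. Type (3,0)+(0,3) means that [J]
    may be moved from one argument to another, and integrability enters as a torsion-free connection
    on [N] with [J] parallel, lifted to [Y] modulo [V]; covariant derivatives of [chi] then keep the
    type. The covariant derivative of the imaginary counterpart is, up to a factor, that of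
    [chi / t] with [J] inserted in one form argument, so its closedness on ([J u], [v], [w], [J w])
    becomes that of [chi / t] on ([u], [v], [w], [J w]). Such quadruples, with [w]
    complex-orthogonal to [u] and [v], are enough for the injectivity of [sigma /\ .] on 2-forms. *)

Section Tuples.
Variables (T : Type) (n : nat).
Implicit Types u v w z : 'rV[T]_n.

Definition mx2 u v : 'M[T]_(2, n) := col_mx u v.
Definition mx3 u v w : 'M[T]_(3, n) := col_mx u (mx2 v w).
Definition mx4 u v w z : 'M[T]_(4, n) := col_mx u (mx3 v w z).
Definition mx5 u v w z y : 'M[T]_(5, n) := col_mx u (mx4 v w z y).

Lemma mx2E u v (a : 'I_2) c : mx2 u v a c = nth (u 0 c) [:: u 0 c; v 0 c] a.
Proof.
rewrite /mx2 mxE; case: splitP => [[[]// lt1] /= ->|j ->] /=.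
  by congr (u _ _); apply: val_inj.
by case: j => [[|//] lt1] /=; congr (v _ _); apply: val_inj.
Qed.

Lemma mx3E u v w (a : 'I_3) c :
  mx3 u v w a c = nth (u 0 c) [:: u 0 c; v 0 c; w 0 c] a.
Proof.
rewrite /mx3 mxE; case: splitP => [[[]// lt1] /= ->|j ->] /=.
  by congr (u _ _); apply: val_inj.
by rewrite mx2E; case: j => [[|[|]]].
Qed.

Lemma mx4E u v w z (a : 'I_4) c :
  mx4 u v w z a c = nth (u 0 c) [:: u 0 c; v 0 c; w 0 c; z 0 c] a.
Proof.
rewrite /mx4 mxE; case: splitP => [[[]// lt1] /= ->|j ->] /=.
  by congr (u _ _); apply: val_inj.
by rewrite mx3E; case: j => [[|[|[|]]]].
Qed.

Lemma mx5E u v w z y (a : 'I_5) c : mx5 u v w z y a c =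
  nth (u 0 c) [:: u 0 c; v 0 c; w 0 c; z 0 c; y 0 c] a.
Proof.
rewrite /mx5 mxE; case: splitP => [[[]// lt1] /= ->|j ->] /=.
  by congr (u _ _); apply: val_inj.
by rewrite mx4E; case: j => [[|[|[|[|]]]]].
Qed.

Lemma mx3_eta (A : 'M[T]_(3, n)) :
  A = mx3 (row 0 A) (row 1 A) (row (inord 2) A).
Proof.
apply/matrixP => a c; rewrite mx3E !mxE.
by case: a => [[|[|[|//]]] lt] /=; congr (A _ _); apply: val_inj; rewrite //= inordK.
Qed.

End Tuples.

Lemma mx2M (R : pzRingType) n m (u v : 'rV[R]_n) (E : 'M_(n, m)) :
  mx2 u v *m E = mx2 (u *m E) (v *m E).
Proof. exact: (mul_col_mx u v E). Qed.

Lemma mx3M (R : pzRingType) n m (u v w : 'rV[R]_n) (E : 'M_(n, m)) :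
  mx3 u v w *m E = mx3 (u *m E) (v *m E) (w *m E).
Proof. by rewrite -[RHS]/(col_mx _ _) -mx2M; exact: (mul_col_mx u _ E). Qed.

Lemma mx4M (R : pzRingType) n m (u v w z : 'rV[R]_n) (E : 'M_(n, m)) :
  mx4 u v w z *m E = mx4 (u *m E) (v *m E) (w *m E) (z *m E).
Proof. by rewrite -[RHS]/(col_mx _ _) -mx3M; exact: (mul_col_mx u _ E). Qed.

(** * Determinants as explicit polynomials *)

Section Laplace.
Variable R : comPzRingType.

(** Entries are indexed by natural numbers so that, for a concrete size, the expansion unfolds to a
    polynomial on which [ring] works. *)
Fixpoint laplace (n : nat) (f : nat -> nat -> R) : R :=
  if n is n'.+1 then
    \sum_(j < n) (-1) ^+ j * f 0%N j * laplace n' (fun a b => f a.+1 (bump j b))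
  else 1.

Lemma laplaceE n (f : nat -> nat -> R) : \det (\matrix_(i < n, j < n) f i j) = laplace n f.
Proof.
elim: n f => [|n IH] f /=; first by rewrite det_mx00.
rewrite (expand_det_row _ ord0); apply: eq_bigr => j _.
rewrite /cofactor mxE -IH add0n /= mulrCA mulrA; congr (_ * \det _).
by apply/matrixP => a b; rewrite !mxE.
Qed.

Lemma eq_laplace n (f g : nat -> nat -> R) :
  (forall i j, (i < n)%N -> (j < n)%N -> f i j = g i j) -> laplace n f = laplace n g.
Proof.
move=> fg; rewrite -!laplaceE; congr (\det _); apply/matrixP => i j.
by rewrite !mxE fg.
Qed.

Lemma laplace_unit_row n (f : nat -> nat -> R) c : (c <= n)%N ->
  (forall j, f 0%N j = (j == c)%:R) ->
  laplace n.+1 f = (-1) ^+ c * laplace n (fun a b => f a.+1 (bump c b)).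
Proof.
rewrite -ltnS => cn f0 /=; rewrite (bigD1 (Ordinal cn)) //= big1 ?addr0.
  by rewrite f0 eqxx mulr1.
move=> j; rewrite f0 -val_eqE /= => /negbTE->.
by rewrite mulr0 mul0r.
Qed.

End Laplace.

(** * The cross product of imaginary octonions *)

Section Octonions.
Variable R : realType.
Implicit Types u v w z : 'rV[R]_7.

Definition co u (a : nat) : R := u 0 (inord a).

Lemma sum7 (F : 'I_7 -> R) : \sum_i F i =
  F (inord 0) + F (inord 1) + F (inord 2) + F (inord 3) + F (inord 4)
  + F (inord 5) + F (inord 6).
Proof.
rewrite !big_ord_recl big_ord0 addr0 !addrA.
by do !congr (_ + _); congr F; apply: val_inj; rewrite /= inordK.
Qed.

Lemma coP u v : co u 0 = co v 0 -> co u 1 = co v 1 -> co u 2 = co v 2 ->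
  co u 3 = co v 3 -> co u 4 = co v 4 -> co u 5 = co v 5 -> co u 6 = co v 6 ->
  u = v.
Proof.
move=> h0 h1 h2 h3 h4 h5 h6; apply/rowP => a; rewrite -(inord_val a).
by case: a => -[|[|[|[|[|[|[|]]]]]]].
Qed.

Definition dot u v : R := (u *m v^T) 0 0.

Lemma dotE u v : dot u v =
  co u 0 * co v 0 + co u 1 * co v 1 + co u 2 * co v 2 + co u 3 * co v 3
  + co u 4 * co v 4 + co u 5 * co v 5 + co u 6 * co v 6.
Proof. by rewrite /dot mxE sum7 !mxE. Qed.

Definition plucker u v (a b : nat) : R := co u a * co v b - co u b * co v a.

Definition cross0 u v : 'rV[R]_7 := \row_j
  nth 0 [:: plucker u v 1 6 + plucker u v 2 4 - plucker u v 3 5;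
            plucker u v 6 0 - plucker u v 2 5 - plucker u v 3 4;
            plucker u v 3 6 + plucker u v 4 0 - plucker u v 5 1;
            plucker u v 6 2 - plucker u v 5 0 - plucker u v 4 1;
            plucker u v 5 6 + plucker u v 0 2 - plucker u v 1 3;
            plucker u v 6 4 - plucker u v 0 3 - plucker u v 1 2;
            plucker u v 0 1 + plucker u v 2 3 + plucker u v 4 5] j.

Lemma co_cross0 u v a : (a < 7)%N -> co (cross0 u v) a =
  nth 0 [:: plucker u v 1 6 + plucker u v 2 4 - plucker u v 3 5;
            plucker u v 6 0 - plucker u v 2 5 - plucker u v 3 4;
            plucker u v 3 6 + plucker u v 4 0 - plucker u v 5 1;
            plucker u v 6 2 - plucker u v 5 0 - plucker u v 4 1;
            plucker u v 5 6 + plucker u v 0 2 - plucker u v 1 3;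
            plucker u v 6 4 - plucker u v 0 3 - plucker u v 1 2;
            plucker u v 0 1 + plucker u v 2 3 + plucker u v 4 5] a.
Proof. by move=> a7; rewrite /co mxE inordK. Qed.

Lemma ewedge3E u v w a b c :
  ewedge [:: a.+1; b.+1; c.+1] (mx3 u v w) =
  co u a * (co v b * co w c - co v c * co w b)
  - co u b * (co v a * co w c - co v c * co w a)
  + co u c * (co v a * co w b - co v b * co w a).
Proof.
pose f i j := nth 0 [:: co u (nth 0%N [:: a; b; c] j);
  co v (nth 0%N [:: a; b; c] j); co w (nth 0%N [:: a; b; c] j)] i.
rewrite /ewedge; have -> : (\matrix_(i < 3, j < 3)
    mx3 u v w i (inord (nth 1%N [:: a.+1; b.+1; c.+1] j).-1))
    = \matrix_(i < 3, j < 3) f i j.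
  apply/matrixP => i j; rewrite [LHS]mxE [RHS]mxE mx3E /f /co.
  by case: i => [[|[|[|//]]]] ?; case: j => [[|[|[|//]]]].
rewrite laplaceE /laplace !big_ord_recl !big_ord0 /f /=.
rewrite /bump /=; ring.
Qed.

Lemma phi0E u v w : phi0 (mx3 u v w) = dot (cross0 u v) w.
Proof.
rewrite /phi0 !ewedge3E dotE !co_cross0 //= /plucker; ring.
Qed.

Lemma coD u v a : co (u + v) a = co u a + co v a.
Proof. by rewrite /co mxE. Qed.

Lemma coZ (c : R) u a : co (c *: u) a = c * co u a.
Proof. by rewrite /co mxE. Qed.

(** The source of the quadratic relations used later: the square of [J], the type of [chi] and the
    skew-symmetry of [*phi] in its middle arguments are specialisations. *)
Lemma cross0_malcev u v w :
  cross0 u (cross0 v w) + cross0 v (cross0 u w)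
  = (- 2 * dot u v) *: w + dot u w *: v + dot v w *: u.
Proof.
by apply: coP; rewrite !(coD, coZ) !dotE co_cross0 //= co_cross0 //= /plucker
  !co_cross0 //= /plucker; ring.
Qed.

End Octonions.

(** * The Hodge dual of the model 3-form *)

Section Hodge.
Variable R : realType.
Implicit Types u v w z : 'rV[R]_7.

(** In the permutation expansion of [ewedge], each permutation leaves exactly one index tuple [f],
    and its sign cancels against the sign produced by [G]; the [k!] terms are therefore equal. *)
Lemma sum_ewedge_alternating n k (c : seq nat) (G : {ffun 'I_k -> 'I_n.+1} -> R) :
  (forall (s : 'S_k) (f : {ffun 'I_k -> 'I_n.+1}), G [ffun a => f (s a)] = (-1) ^+ s * G f) ->
  \sum_(f : {ffun 'I_k -> 'I_n.+1}) ewedge c (rowsub f 1%:M) * G f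
  = (k`!)%:R * G [ffun a : 'I_k => inord (nth 1%N c a).-1].
Proof.
move=> Galt; set g := [ffun a : 'I_k => _].
transitivity (\sum_(f : {ffun 'I_k -> 'I_n.+1}) \sum_(s : 'S_k)
    (-1) ^+ s * ((f == [ffun a => g (s a)])%:R * G f)).
  apply: eq_bigr => f _; rewrite /ewedge /determinant mulr_suml.
  apply: eq_bigr => s _; rewrite -mulrA; congr (_ * (_ * _)).
  under eq_bigr => i _ do rewrite !mxE.
  case: eqP => [->|fg].
    by rewrite big1 // => i _; rewrite !ffunE eqxx.
  have [i fgi] : exists i, f i != g (s i).
    apply/existsP; rewrite -negb_forall; apply/negP => /forallP h.
    by apply: fg; apply/ffunP => i; rewrite ffunE; apply/eqP.
  move: fgi; rewrite /g ffunE => fgi.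
  by rewrite (bigD1 i) //= (negbTE fgi) mul0r.
rewrite exchange_big /= -card_Sn -sum1_card natr_sum mulr_suml.
apply: eq_big => [s|s _]; first by rewrite inE.
rewrite (bigD1 [ffun a => g (s a)]) //= big1 ?addr0; last first.
  by move=> f /negbTE->; rewrite mul0r mulr0.
by rewrite eqxx mul1r Galt mulrA -expr2 sqrr_sign.
Qed.

Lemma det_col_mx_perm k m (s : 'S_k) (A : 'M[R]_(k, k + m)) (B : 'M_(m, k + m)) :
  \det (col_mx (row_perm s A) B) = (-1) ^+ s * \det (col_mx A B).
Proof.
pose L : 'M[R]_(k + m) := block_mx (perm_mx s) 0 0 1%:M.
have -> : col_mx (row_perm s A) B = L *m col_mx A B.
  by rewrite mul_block_col !mul0mx mul1mx addr0 add0r row_permE.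
by rewrite det_mulmx det_ublock det1 mulr1 det_perm.
Qed.

Definition vol7 (c : {ffun 'I_3 -> 'I_7}) (B : 'M[R]_(4, 7)) : R :=
  \det (col_mx (rowsub c (1%:M : 'M_(3 + 4))) (B : 'M_(4, 3 + 4))).

Definition minor4 (a b c d : nat) u v w z : R :=
  laplace 4 (fun i j => nth 0 [:: co u (nth 0%N [:: a; b; c; d] j);
     co v (nth 0%N [:: a; b; c; d] j); co w (nth 0%N [:: a; b; c; d] j);
     co z (nth 0%N [:: a; b; c; d] j)] i).

Lemma vol7E (c : {ffun 'I_3 -> 'I_7}) u v w z :
  vol7 c (mx4 u v w z) = laplace 7 (fun i j =>
    if (i < 3)%N then (j == c (inord i) :> nat)%:R else
    nth 0 [:: co u j; co v j; co w j; co z j] (i - 3)).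
Proof.
rewrite -laplaceE /vol7; congr (\det _); apply/matrixP => i j.
rewrite [RHS]mxE; have -> : i = inord i by rewrite inord_val.
rewrite -(inord_val i) [LHS]mxE.
case: splitP => k; rewrite !inord_val => ik.
  by rewrite ik (ltn_ord k) !mxE inord_val eq_sym -val_eqE.
rewrite ik ltnNge leq_addr /= addKn.
by rewrite mx4E /co inord_val; case: k {ik} => [[|[|[|[|]]]]].
Qed.

Lemma bump_eq h i j : (bump h i == bump h j) = (i == j).
Proof. exact: (inj_eq (can_inj (@bumpK h))). Qed.

Lemma bump_lt h i n : (h <= n)%N -> (i < n)%N -> (bump h i < n.+1)%N.
Proof. by rewrite /bump; case: (h <= i)%N => // _ /ltnW. Qed.

(** [b] and [d] are positions among the columns left after the earlier deletions, and [bump]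
    converts them to true column numbers. Three expansions along unit rows then apply in
    succession. *)
Lemma vol7_unit a b d u v w z : (a <= 6)%N -> (b <= 5)%N -> (d <= 4)%N ->
  let g j := bump a (bump b (bump d j)) in
  vol7 [ffun i : 'I_3 => inord
         (nth 1%N [:: a.+1; (bump a b).+1; (bump a (bump b d)).+1] i).-1]
       (mx4 u v w z) =
  (-1) ^+ a * ((-1) ^+ b * ((-1) ^+ d * minor4 (g 0) (g 1) (g 2) (g 3) u v w z)).
Proof.
move=> a6 b5 d4 g; rewrite vol7E.
rewrite (laplace_unit_row (c := a)) //; last by move=> j; rewrite ffunE !inordK.
congr (_ * _).
rewrite (laplace_unit_row (c := b)) //; last first.
  by move=> j; rewrite ffunE !inordK ?bump_eq //= ?inordK // bump_lt.
congr (_ * _).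
rewrite (laplace_unit_row (c := d)) //; last first.
  move=> j; rewrite ffunE !inordK ?bump_eq //= ?inordK ?bump_eq //.
  by rewrite !bump_lt.
congr (_ * _); apply: eq_laplace => i j i4 j4.
by move: i i4 j j4 => [|[|[|[|//]]]] _ [|[|[|[|//]]]].
Qed.

Lemma minor4E a b c d u v w z : minor4 a b c d u v w z =
    plucker u v a b * plucker w z c d - plucker u v a c * plucker w z b d +
      plucker u v a d * plucker w z b c
  + plucker u v b c * plucker w z a d - plucker u v b d * plucker w z a c +
    plucker u v c d * plucker w z a b.
Proof.
rewrite /minor4 /laplace !big_ord_recl !big_ord0 /= /bump /plucker /=; ring.
Qed.

Lemma vol7_alternating (B : 'M[R]_(4, 7)) (s : 'S_3) (f : {ffun 'I_3 -> 'I_7}) :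
  vol7 [ffun a => f (s a)] B = (-1) ^+ s * vol7 f B.
Proof.
rewrite /vol7 -det_col_mx_perm; congr (\det (col_mx _ _)).
by apply/matrixP => i j; rewrite !mxE ffunE.
Qed.

Lemma hodge_phi0 u v w z :
  (3`!%:R)^-1 * (\sum_(s : {ffun 'I_3 -> 'I_7})
     phi0 (rowsub s (1%:M : 'M[R]_7)) * vol7 s (mx4 u v w z))
  = dot (cross0 (cross0 u v) w) z - dot u w * dot v z + dot u z * dot v w.
Proof.
set G := fun s => vol7 s (mx4 u v w z).
have ew (a b d : nat) :
    \sum_(s : {ffun 'I_3 -> 'I_7}) ewedge [:: a; b; d] (rowsub s 1%:M) * G s
    = 3`!%:R * G [ffun i : 'I_3 => inord (nth 1%N [:: a; b; d] i).-1].
  by apply: sum_ewedge_alternating => s f; exact: vol7_alternating.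
rewrite /phi0.
under eq_bigr do rewrite !(mulrDl, mulNr).
rewrite !(big_split, sumrN) /= !ew /G.
have vu (a b d : nat) := @vol7_unit a b d u v w z.
(* The seven argument triples encode, in this order, the index triples 127, 347, 567, 135, 146, 236
   and 245 of [phi0]. *)
move: (vu 0%N 0%N 4%N isT isT isT); rewrite /bump /= => ->.
move: (vu 2%N 2%N 4%N isT isT isT); rewrite /bump /= => ->.
move: (vu 4%N 4%N 4%N isT isT isT); rewrite /bump /= => ->.
move: (vu 0%N 1%N 2%N isT isT isT); rewrite /bump /= => ->.
move: (vu 0%N 2%N 3%N isT isT isT); rewrite /bump /= => ->.
move: (vu 1%N 1%N 3%N isT isT isT); rewrite /bump /= => ->.
move: (vu 1%N 2%N 2%N isT isT isT); rewrite /bump /= => ->.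
rewrite /= !minor4E /bump /= !dotE co_cross0 //= co_cross0 //= co_cross0 //=.
rewrite co_cross0 //= co_cross0 //= co_cross0 //= co_cross0 //=.
have f6 : (3`!%:R : R) = 6 by [].
rewrite f6 /plucker !co_cross0 //= /plucker.
by field.
Qed.

End Hodge.

(** * Pointwise algebra of a G2 structure with a distinguished vector *)

Section LinearAlgebra.
Variables (R : realType) (W : lmodType R).

Definition lin (f : W -> R) := forall c u v, f (c *: u + v) = c * f u + f v.

Lemma lin0 f : lin f -> f 0 = 0.
Proof. by move=> fl; have := fl (-1) 0 0; rewrite scaler0 addr0 mulN1r addNr. Qed.

Lemma linD f u v : lin f -> f (u + v) = f u + f v.
Proof. by move=> fl; have := fl 1 u v; rewrite scale1r mul1r. Qed.

Lemma linZ f c u : lin f -> f (c *: u) = c * f u.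
Proof. by move=> fl; have := fl c u 0; rewrite lin0 // !addr0. Qed.

Lemma linN f u : lin f -> f (- u) = - f u.
Proof. by move=> fl; rewrite -scaleN1r linZ // mulN1r. Qed.

Lemma linB f u v : lin f -> f (u - v) = f u - f v.
Proof. by move=> fl; rewrite linD // linN. Qed.

Record alternating3 (f : W -> W -> W -> R) : Prop := Alternating3 {
  alt3_lin : forall b c, lin (fun a => f a b c);
  alt3_12 : forall a b c, f a b c = - f b a c;
  alt3_23 : forall a b c, f a b c = - f a c b }.

Section Alternating3.
Variable f : W -> W -> W -> R.
Hypothesis fA : alternating3 f.

Lemma alt3_lin2 a c : lin (fun b => f a b c).
Proof. by move=> e u v; rewrite !(alt3_12 fA a) (alt3_lin fA); ring. Qed.

Lemma alt3_lin3 a b : lin (fun c => f a b c).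
Proof. by move=> e u v; rewrite !(alt3_23 fA a b) alt3_lin2; ring. Qed.

Lemma alt3_cycle a b c : f a b c = f b c a.
Proof. by rewrite (alt3_12 fA) (alt3_23 fA) opprK. Qed.

Lemma alt3_eq12 a b : f a a b = 0.
Proof. by have := alt3_12 fA a a b; lra. Qed.

Lemma alt3_eq13 a b : f a b a = 0.
Proof. by rewrite (alt3_23 fA) alt3_eq12 oppr0. Qed.

End Alternating3.

(* [C] is the cross product, [k (C u v) w = phi u v w]; [g2_malcev] polarizes
   u x (u x w) = - |u|^2 w + <u, w> u. *)
Record g2_point (k : W -> W -> R) (phi : W -> W -> W -> R)
    (psi : W -> W -> W -> W -> R) (C : W -> W -> W) : Prop := G2Point {
  g2_klin : forall v, lin (k ^~ v);
  g2_ksym : forall u v, k u v = k v u;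
  g2_kdef : forall u, k u u = 0 -> u = 0;
  g2_alt : alternating3 phi;
  g2_cross : forall u v w, k (C u v) w = phi u v w;
  g2_malcev : forall u v w, C u (C v w) + C v (C u w)
    = (- 2 * k u v) *: w + k u w *: v + k v w *: u;
  g2_psi : forall a b c d, psi a b c d
    = phi (C a b) c d - k a c * k b d + k a d * k b c }.

End LinearAlgebra.

Section G2Algebra.
Variables (R : realType) (W : lmodType R).
Variables (k : W -> W -> R) (phi : W -> W -> W -> R).
Variables (psi : W -> W -> W -> W -> R) (C : W -> W -> W).
Hypothesis G : g2_point k phi psi C.

Let kl := g2_klin G.
Let ks := g2_ksym G.
Let pA := g2_alt G.

Lemma g2_klinr u : lin (k u).
Proof. by move=> c v w; rewrite !(ks u) kl. Qed.
Let kr := g2_klinr.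

Lemma g2_knondeg u v : (forall w, k u w = k v w) -> u = v.
Proof.
move=> uv; apply/eqP; rewrite -subr_eq0; apply/eqP/(g2_kdef G).
by rewrite (linB _ _ (kl _)) uv subrr.
Qed.

Lemma g2_malcevk u v w z : phi u (C v w) z + phi v (C u w) z
  = - 2 * k u v * k w z + k u w * k v z + k v w * k u z.
Proof.
rewrite -!(g2_cross G) -(linD _ _ (kl z)) (g2_malcev G).
by rewrite !(linD _ _ (kl z)) !(linZ _ _ (kl z)).
Qed.

Lemma g2_crossC u v : C u v = - C v u.
Proof.
apply: g2_knondeg => w.
by rewrite (linN _ (kl _)) !(g2_cross G) (alt3_12 pA).
Qed.

Lemma g2_psi_12 a b c d : psi a b c d = - psi b a c d.
Proof.
by rewrite !(g2_psi G) [C b a]g2_crossC (linN _ (alt3_lin pA _ _)); ring.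
Qed.

(** Not visible in the formula for [psi]: it is the paired Malcev identity for [c], [b], [a],
    [d]. *)
Lemma g2_psi_23 a b c d : psi a b c d = - psi a c b d.
Proof.
have := g2_malcevk c b a d.
rewrite (alt3_12 pA c) (alt3_12 pA b) (g2_crossC b) (g2_crossC c).
rewrite !(linN _ (alt3_lin pA _ _)) !(g2_psi G) !opprK.
rewrite (ks c b) (ks c a) (ks b a); lra.
Qed.

(* [f] is the unit vector t V, so that [J] is the lift of the almost complex
   structure and [hpart] the horizontal part of [phi]. *)
Variable f : W.
Hypothesis f1 : k f f = 1.

Local Notation J := (C f).

Lemma acs_phi u v : k (J u) v = phi f u v.
Proof. exact: (g2_cross G). Qed.

Lemma acs_skew u v : k (J u) v = - k u (J v).
Proof. by rewrite (ks u) !acs_phi (alt3_23 pA). Qed.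

Lemma acs_unit u : k (J u) f = 0.
Proof. by rewrite acs_phi (alt3_eq13 pA). Qed.

Lemma acs_sqr u : J (J u) = - u + k f u *: f.
Proof.
have := g2_malcev G f f u; rewrite f1 mulr1 -!/(J _) => /eqP.
rewrite -!mulr2n -addrA -mulr2n -scaler_nat => /eqP e.
apply: (@scalerI _ _ 2%:R); first by rewrite pnatr_eq0.
by rewrite e scalerDr scalerN scaleNr scaler_nat.
Qed.

Lemma acs_isometry u v : k (J u) (J v) = k u v - k f u * k f v.
Proof.
rewrite acs_skew acs_sqr (linD _ _ (kr u)) (linN _ (kr u)) (linZ _ _ (kr u)).
by rewrite (ks u f); ring.
Qed.

(** The Malcev identity with [f] as one factor. On horizontal arguments the right-hand side
    vanishes, which is the origin of the type of [chi]. *)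
Lemma phi_acsC u v w : phi u (J v) w - phi u v (J w)
  = - 2 * k f u * k v w + k f v * k u w + k u v * k f w.
Proof.
rewrite -g2_malcevk; have -> : phi u v (J w) = - phi f (C u v) w.
  by rewrite -!(g2_cross G) -/(J _) acs_skew opprK.
by rewrite opprK addrC.
Qed.

Definition hpart a b c : R :=
  phi a b c - (phi f a b * k f c + phi f b c * k f a + phi f c a * k f b).

Lemma hpart_alt : alternating3 hpart.
Proof.
split=> [b c e u v|a b c|a b c]; rewrite /hpart.
- rewrite (alt3_lin pA) (alt3_lin2 pA) (alt3_lin3 pA) kr; ring.
- rewrite (alt3_12 pA a b c) (alt3_23 pA f a b) (alt3_23 pA f b c).
  by rewrite (alt3_23 pA f c a); ring.
- rewrite (alt3_23 pA a b c) (alt3_23 pA f a b) (alt3_23 pA f b c).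
  by rewrite (alt3_23 pA f c a); ring.
Qed.

Lemma hpart_unit b c : hpart f b c = 0.
Proof. by rewrite /hpart (alt3_eq12 pA) (alt3_eq13 pA) f1; ring. Qed.

(** The terms subtracted in [hpart] account exactly for the right-hand side of [phi_acsC], so that
    no horizontality is required of the arguments. *)
Lemma hpart_acs23 u v w : hpart u (J v) w = hpart u v (J w).
Proof.
have := phi_acsC u v w; rewrite /hpart.
rewrite -!acs_phi !acs_sqr !(linD _ _ (kl _)) !(linN _ (kl _)) !(linZ _ _ (kl _)).
rewrite !(ks f (J _)) !acs_unit !acs_isometry.
rewrite !(ks v) !(ks w) !(ks u); lra.
Qed.

Lemma hpart_acs12 u v w : hpart (J u) v w = hpart u (J v) w.
Proof.
by rewrite (alt3_cycle hpart_alt (J u)) -hpart_acs23 -(alt3_cycle hpart_alt u)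
  hpart_acs23.
Qed.

(* The horizontal part of [w x (u x v)_H], paired with [z]. *)
Let triple w u v z := phi w (C u v) z - k f (C u v) * phi w f z.

Let hcross u v := C u v - k f (C u v) *: f.

Let tripleE w u v z : triple w u v z = phi w (hcross u v) z.
Proof.
by rewrite /hcross (linB _ _ (alt3_lin2 pA _ _)) (linZ _ _ (alt3_lin2 pA _ _)).
Qed.

Let hcross_unit u v : k f (hcross u v) = 0.
Proof. by rewrite (linB _ _ (kr _)) (linZ _ _ (kr _)) f1 mulr1 subrr. Qed.

Let phi_hor u v w : k f u = 0 -> k f v = 0 -> k f w = 0 ->
  phi u v w = hpart u v w.
Proof. by move=> u0 v0 w0; rewrite /hpart u0 v0 w0; ring. Qed.

Lemma acs_hor u : k f (J u) = 0.
Proof. by rewrite ks acs_unit. Qed.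

Lemma acs_sqr_hor u : k f u = 0 -> J (J u) = - u.
Proof. by rewrite acs_sqr => ->; rewrite scale0r addr0. Qed.

Lemma hor_dec z : exists z' c, k f z' = 0 /\ z = z' + c *: f.
Proof.
exists (z - k f z *: f), (k f z); rewrite subrK; split=> //.
by rewrite (linB _ _ (kr _)) (linZ _ _ (kr _)) f1 mulr1 subrr.
Qed.

Let hcross_acs w v : k f w = 0 -> k f v = 0 ->
  hcross (J w) v = - J (hcross w v).
Proof.
move=> w0 v0; apply: g2_knondeg => z; have [z' [c [z'0 ->]]] := hor_dec z.
rewrite !(linD _ _ (kr _)) !(linZ _ _ (kr _)) !(linN _ (kl _)) acs_unit.
rewrite (ks (hcross _ _) f) hcross_unit acs_skew opprK oppr0; congr (_ + _).
rewrite /hcross !(linB _ _ (kl _)) !(linZ _ _ (kl _)) z'0 acs_hor !(g2_cross G).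
by rewrite !phi_hor ?acs_hor // hpart_acs12 hpart_acs23; ring.
Qed.

(* For [u], [v] complex-orthogonal to [w], the complex cross product of [u] and
   [v] is a complex multiple of [w]. *)
Lemma hpart_perp u v w X :
  k f u = 0 -> k f v = 0 -> k f w = 0 ->
  k w u = 0 -> k w v = 0 -> k w (J u) = 0 -> k w (J v) = 0 ->
  k w w * hpart X u v =
  hpart w u v * k w X + hpart (J w) u v * k (J w) X.
Proof.
move=> u0 v0 w0 wu wv wJu wJv.
have Jwu : k (J w) u = 0 by rewrite acs_skew wJu oppr0.
have Jwv : k (J w) v = 0 by rewrite acs_skew wJv oppr0.
have acsT a b c z : k f a = 0 -> k f z = 0 ->
    triple (J a) b c z = triple a b c (J z).
  move=> a0 z0; rewrite !tripleE !phi_hor ?acs_hor ?hcross_unit //.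
  by rewrite hpart_acs12 hpart_acs23.
have acsT' a b c z : k f a = 0 -> k f b = 0 -> k f c = 0 -> k f z = 0 ->
    triple a (J b) c z = - triple a b c (J z).
  move=> a0 b0 c0 z0; rewrite !tripleE hcross_acs // (linN _ (alt3_lin2 pA _ _)).
  by rewrite !phi_hor ?acs_hor ?hcross_unit // hpart_acs23.
have sumT a z : k f a = 0 -> k f z = 0 -> k a u = 0 -> k a v = 0 ->
    k (J a) v = 0 ->
    triple a u v z + triple u a v z = k (J u) v * k (J a) z + k u v * k a z.
  move=> a0 z0 au av Jav; have := g2_malcevk a u v z.
  rewrite /triple -(ks (C u v)) -(ks (C a v)) !(g2_cross G) au av !mul0r mulr0 mul0r.
  rewrite -(alt3_cycle pA f) -acs_phi -(alt3_cycle pA f) -acs_phi Jav.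
  by rewrite (alt3_12 pA a f) -acs_phi; lra.
(* Replacing [w], [z] by [J w], [J z] in [sumT] changes the sign of the first summand and preserves
   the second summand and the right-hand side, so the first summand is zero. *)
have T0 z : k f z = 0 -> triple w u v z = 0.
  move=> z0; have e1 := sumT w z w0 z0 wu wv Jwv.
  have JJwv : k (J (J w)) v = 0.
    by rewrite acs_sqr_hor // (linN _ (kl _)) wv oppr0.
  have := sumT (J w) (J z) (acs_hor _) (acs_hor _) Jwu Jwv JJwv.
  rewrite acsT ?acs_hor // acsT' ?acs_hor // !acs_sqr_hor //.
  rewrite !tripleE !(linN _ (alt3_lin3 pA _ _)) -!tripleE.
  rewrite (linN _ (kl _)) acs_isometry w0 mul0r subr0.
  have -> : k w (J z) = - k (J w) z by rewrite acs_skew opprK.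
  lra.
have [X' [c [X'0 ->]]] := hor_dec X.
rewrite !(linD _ _ (kr _)) !(linZ _ _ (kr _)) acs_unit (ks w f) w0 !mulr0 !addr0.
rewrite (linD _ _ (alt3_lin hpart_alt _ _)) (linZ _ _ (alt3_lin hpart_alt _ _)).
rewrite hpart_unit mulr0 addr0.
(* By [T0] the product of [w] and [p] is vertical, hence a multiple of [f]. Multiplying by [w] once
   more and applying the Malcev identity expresses [k w w *: p] through [w] and [J w]. *)
pose p := hcross u v.
have Cwp z : k f z = 0 -> k (C w p) z = 0.
  by move=> z0; rewrite (g2_cross G) -tripleE T0.
have fdec y : k (C w p) y = k f y * k (C w p) f.
  have [z [e [z0 ->]]] := hor_dec y.
  rewrite !(linD _ _ (kr _)) Cwp // !(linZ _ _ (kr _)) z0 f1; ring.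
have := g2_malcevk w w p X'.
rewrite (alt3_23 pA w) -(g2_cross G) (ks (C w X')) fdec (ks f (C w X')) !(g2_cross G).
rewrite (alt3_23 pA w p) (alt3_12 pA w f) -!acs_phi.
rewrite -(alt3_cycle pA f w X') -acs_phi.
have kpE z : k f z = 0 -> k p z = hpart z u v.
  move=> z0; rewrite (linB _ _ (kl _)) (linZ _ _ (kl _)) z0 (g2_cross G).
  by rewrite -(alt3_cycle pA) phi_hor //; ring.
rewrite (ks w p) (kpE X') // (kpE w) // (ks _ p) (kpE (J w)) ?acs_hor //.
lra.
Qed.

End G2Algebra.

(** * The model structure in an adapted coframe *)

Section Coframe.
Variables (R : realType) (E : 'M[R]_7).
Hypothesis uE : E \in unitmx.
Implicit Types u v w a b c d : 'rV[R]_7.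

(** The cross product recovered from the metric and the 3-form through the inverse Gram matrix. As
    no coframe is involved, it inherits its regularity in the point from [K] and [f]. *)
Definition cross_of (K : 'rV[R]_7 -> 'rV[R]_7 -> R)
    (f : 'rV[R]_7 -> 'rV[R]_7 -> 'rV[R]_7 -> R) a b : 'rV[R]_7 :=
  (\row_c f a b (delta_mx 0 c)) *m
  invmx (\matrix_(i, j) K (delta_mx 0 i) (delta_mx 0 j)).

Let K u v := coframe_metric E (mx2 u v).
Let f a b c := phi0 (mx3 a b c *m E).

Lemma coframe_metricE u v : K u v = dot (u *m E) (v *m E).
Proof.
rewrite /K /coframe_metric /dot.
have -> : row 0 (mx2 u v) = u by apply/rowP => c; rewrite [LHS]mxE mx2E.
have -> : row 1 (mx2 u v) = v by apply/rowP => c; rewrite [LHS]mxE mx2E.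
by [].
Qed.

Lemma dot_eq0 u : dot u u = 0 -> u = 0.
Proof.
rewrite /dot mxE => /eqP; rewrite psumr_eq0 => [/allP h|i _]; last first.
  by rewrite mxE -expr2 sqr_ge0.
apply/rowP => c; have := h c; rewrite mem_index_enum => /(_ isT) /=.
by rewrite [_^T _ _]mxE mulf_eq0 orbb [RHS]mxE => /eqP.
Qed.

Lemma rowsub_mulr n k (s : 'I_k -> 'I_n) (A B : 'M[R]_n) :
  rowsub s A *m B = rowsub s (A *m B).
Proof. by apply/matrixP => i j; rewrite !mxE; apply: eq_bigr => l _; rewrite !mxE. Qed.

Lemma hodge_coframe a b c d (w : 'M[R]_(3, 7) -> R) :
  (forall A, w A = phi0 (A *m E)) ->
  @coframe_hodge R 3 4 E w (mx4 a b c d)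
  = dot (cross0 (cross0 (a *m E) (b *m E)) (c *m E)) (d *m E)
    - dot (a *m E) (c *m E) * dot (b *m E) (d *m E)
    + dot (a *m E) (d *m E) * dot (b *m E) (c *m E).
Proof.
move=> wE; rewrite -hodge_phi0 /coframe_hodge; congr (_ * _).
apply: eq_bigr => s _; rewrite wE rowsub_mulr mulVmx //; congr (_ * _).
rewrite /vol7 mul_col_mx; congr (\det (col_mx _ _)); last exact: mx4M.
by rewrite rowsub_mulr mulVmx.
Qed.

Lemma dot_lin v : lin (fun u => dot u v).
Proof. by move=> e u w; rewrite /dot mulmxDl -scalemxAl !mxE. Qed.

Lemma dotC u v : dot u v = dot v u.
Proof. by rewrite !dotE; ring. Qed.

Lemma phi0_alt : alternating3 (fun a b c => dot (cross0 a b) c).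
Proof.
split=> [b c e u v|a b c|a b c]; rewrite !dotE !co_cross0 //= /plucker ?coD ?coZ; ring.
Qed.

Lemma coframe_g2_point : g2_point K f
  (fun a b c d => @coframe_hodge R 3 4 E (fun A => phi0 (A *m E)) (mx4 a b c d))
  (fun a b => cross0 (a *m E) (b *m E) *m invmx E).
Proof.
split=> [v e u w|u v|u|||u v w|a b c d].
- by rewrite !coframe_metricE mulmxDl -scalemxAl dot_lin.
- by rewrite !coframe_metricE dotC.
- rewrite coframe_metricE => /dot_eq0 uE0.
  by rewrite -(mulmxK uE u) uE0 mul0mx.
- have [l s t] := phi0_alt; split=> [b c e u v|a b c|a b c]; rewrite /f !mx3M !phi0E.
  + by rewrite mulmxDl -scalemxAl l.
  + exact: s.
  + exact: t.
- by move=> u v w; rewrite coframe_metricE mulmxKV // /f mx3M phi0E.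
- rewrite !mulmxKV // -mulmxDl cross0_malcev !mulmxDl -!scalemxAl !mulmxK //.
  by rewrite !coframe_metricE.
- rewrite (hodge_coframe _ _ _ _ (fun A => erefl)) /f mx3M phi0E mulmxKV //.
  by rewrite !coframe_metricE.
Qed.

Lemma coframe_gram : \matrix_(i, j) K (delta_mx 0 i) (delta_mx 0 j) = E *m E^T.
Proof.
apply/matrixP => i j; rewrite !mxE coframe_metricE /dot -!rowE mxE.
by apply: eq_bigr => l _; rewrite !mxE.
Qed.

Lemma coframe_gram_unit :
  \matrix_(i, j) K (delta_mx 0 i) (delta_mx 0 j) \in unitmx.
Proof. by rewrite coframe_gram unitmx_mul unitmx_tr uE. Qed.

Lemma coframe_cross a b :
  cross_of K f a b = cross0 (a *m E) (b *m E) *m invmx E.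
Proof.
have uT : E^T \in unitmx by rewrite unitmx_tr.
rewrite /cross_of coframe_gram; apply: (canLR (mulmxK _)).
  by rewrite unitmx_mul uE.
rewrite mulmxA mulmxKV //; apply/rowP => c.
rewrite mxE /f mx3M phi0E /dot -rowE !mxE.
by apply: eq_bigr => l _; rewrite !mxE.
Qed.

(** Five linear conditions on seven unknowns; five vectors leave room for [f], [u], [v], [J u],
    [J v], that is, for a horizontal vector complex-orthogonal to two given ones. *)
Lemma coframe_dim a b c d e : exists w,
  [/\ w != 0, K w a = 0, K w b = 0, K w c = 0 & K w d = 0 /\ K w e = 0].
Proof.
pose B : 'M[R]_(5, 7) := mx5 (a *m E) (b *m E) (c *m E) (d *m E) (e *m E).
have : kermx (E *m B^T) != 0.
  rewrite -mxrank_eq0 mxrank_ker -lt0n subn_gt0.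
  by apply: (leq_ltn_trans (rank_leq_col _)).
case/rowV0Pn => w /sub_kermxP wB w0; exists w.
have KwB (l : 'I_5) (p : 'rV[R]_7) : (forall q, B l q = p 0 q) -> dot (w *m E) p = 0.
  move=> Bp; transitivity ((w *m (E *m B^T)) 0 l); last by rewrite wB mxE.
  rewrite mulmxA /dot !mxE; apply: eq_bigr => q _.
  by rewrite [_^T q 0]mxE [_^T q l]mxE Bp.
rewrite !coframe_metricE; split=> //; last split.
- by apply: (KwB 0) => q; rewrite mx5E.
- by apply: (KwB 1) => q; rewrite mx5E.
- by apply: (KwB (inord 2)) => q; rewrite mx5E inordK.
- by apply: (KwB (inord 3)) => q; rewrite mx5E inordK.
- by apply: (KwB (inord 4)) => q; rewrite mx5E inordK.
Qed.

End Coframe.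

(** * Injectivity of the wedge product with the Kähler form *)

Section TwoForms.
Variables (R : realType) (W : lmodType R).
Variables (k : W -> W -> R) (phi : W -> W -> W -> R).
Variables (psi : W -> W -> W -> W -> R) (C : W -> W -> W).
Hypothesis G : g2_point k phi psi C.
Hypothesis dim_gt5 : forall a b c d e, exists w,
  [/\ w != 0, k w a = 0, k w b = 0, k w c = 0 & k w d = 0 /\ k w e = 0].
Variable f : W.
Hypothesis f1 : k f f = 1.
Local Notation J := (C f).
Let kl := g2_klin G.
Let ks := g2_ksym G.
Let kr := g2_klinr G.

Lemma kuu_neq0 u : u != 0 -> k u u != 0.
Proof. by apply: contra_neq => /(g2_kdef G). Qed.

Lemma exists_perp u v : exists w, [/\ w != 0, k f w = 0 &
  [/\ k w u = 0, k w v = 0, k w (J u) = 0 & k w (J v) = 0]].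
Proof.
have [w [w0 wf wu wv [wJu wJv]]] := dim_gt5 f u v (J u) (J v).
by exists w; rewrite ks.
Qed.

(* On three mutually orthogonal complex lines the hypothesis makes the values
   [Om w (J w)], for unit [w], pairwise opposite, hence zero. *)
Lemma two_form_eq0 (Om : W -> W -> R) :
  (forall v, lin (Om ^~ v)) -> (forall u v, Om u v = - Om v u) ->
  (forall u, Om f u = 0) ->
  (forall u v w, k f u = 0 -> k f v = 0 -> k f w = 0 -> k w u = 0 -> k w v = 0 ->
     k w (J u) = 0 -> k w (J v) = 0 -> k w w * Om u v + k (J u) v * Om w (J w) = 0) ->
  forall u v, Om u v = 0.
Proof.
move=> Oml Oms Omf Omw.
have Omr u : lin (Om u) by move=> c v w; rewrite !(Oms u) Oml; ring.
have pair u w : k f u = 0 -> k f w = 0 -> k w u = 0 -> k w (J u) = 0 ->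
    k w w * Om u (J u) + k u u * Om w (J w) = 0.
  move=> u0 w0 wu wJu; have := Omw u (J u) w u0 (acs_hor G f u) w0 wu wJu wJu.
  rewrite (acs_sqr_hor G f1) // (linN _ (kr _)) wu oppr0 => /(_ erefl).
  by rewrite (acs_isometry G f1) u0 mul0r subr0.
have OmJ w : k f w = 0 -> Om w (J w) = 0.
  have [->|w0 wf] := eqVneq w 0; first by rewrite (lin0 (Oml _)).
  have [a [a0 af [aw _ aJw _]]] := exists_perp w w.
  have [b [b0 bf [bw ba bJw bJa]]] := exists_perp w a.
  have e1 := pair w a wf af aw aJw.
  have e2 := pair w b wf bf bw bJw.
  have e3 := pair a b af bf ba bJa.
  have nw := kuu_neq0 w0; have na := kuu_neq0 a0; have nb := kuu_neq0 b0.
  have : 2 * (k a a * k b b) * Om w (J w) = 0.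
    transitivity (k b b * (k a a * Om w (J w) + k w w * Om a (J a))
      + k a a * (k b b * Om w (J w) + k w w * Om b (J b))
      - k w w * (k b b * Om a (J a) + k a a * Om b (J b))); first by ring.
    by rewrite e1 e2 e3; ring.
  by move/eqP; rewrite !mulf_eq0 pnatr_eq0 (negbTE na) (negbTE nb) /= => /eqP.
have Omh u v : k f u = 0 -> k f v = 0 -> Om u v = 0.
  move=> u0 v0; have [w [w0 wf [wu wv wJu wJv]]] := exists_perp u v.
  have := Omw u v w u0 v0 wf wu wv wJu wJv; rewrite OmJ // mulr0 addr0.
  by move/eqP; rewrite mulf_eq0 (negbTE (kuu_neq0 w0)) => /eqP.
move=> u v; have [u' [c [u0 ->]]] := hor_dec G f1 u.
have [v' [d [v0 ->]]] := hor_dec G f1 v.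
rewrite (linD _ _ (Oml _)) (linZ _ _ (Oml _)) Omf (linD _ _ (Omr _)) Omh //.
by rewrite (linZ _ _ (Omr _)) Oms Omf; ring.
Qed.

End TwoForms.

(** * First-order jets at a point *)

Section Jets.
Variables (R : realType) (W : lmodType R).
Variables (k : W -> W -> R) (phi : W -> W -> W -> R).
Variables (psi : W -> W -> W -> W -> R) (C : W -> W -> W).
Hypothesis G : g2_point k phi psi C.
Hypothesis dim_gt5 : forall a b c d e, exists w,
  [/\ w != 0, k w a = 0, k w b = 0, k w c = 0 & k w d = 0 /\ k w e = 0].
Variables (V X : W) (t : R).
Hypothesis t0 : t != 0.

Local Notation f := (t *: V).
Hypothesis f1 : k f f = 1.
Local Notation J := (C f).
Let kl := g2_klin G.
Let ks := g2_ksym G.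
Let kr := g2_klinr G.
Let pA := g2_alt G.

Definition sigma_pt a b := phi V a b.
Definition eta_pt a := t ^+ 2 * k a V.
Definition chi a b c :=
  phi a b c - (sigma_pt a b * eta_pt c + sigma_pt b c * eta_pt a + sigma_pt c a * eta_pt b).

Lemma chiE : chi = hpart k phi f.
Proof.
apply/funext => a; apply/funext => b; apply/funext => c.
rewrite /chi /hpart /sigma_pt /eta_pt !(linZ _ _ (alt3_lin pA _ _)) !(linZ _ _ (kl _)).
by rewrite !(ks V); ring.
Qed.

Let chA : alternating3 chi.
Proof. by rewrite chiE; exact: (hpart_alt G). Qed.

Let chV a b : chi V a b = 0.
Proof.
have := hpart_unit G f1 a b; rewrite -chiE (linZ _ _ (alt3_lin chA _ _)).
by move/eqP; rewrite mulf_eq0 (negbTE t0) => /eqP.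
Qed.

Let chJ12 a b c : chi (J a) b c = chi a (J b) c.
Proof. by rewrite chiE; exact: (hpart_acs12 G f1). Qed.

Let sigE a b : t * sigma_pt a b = k (J a) b.
Proof. by rewrite (acs_phi G) (linZ _ _ (alt3_lin pA _ _)). Qed.

Let sigA a b : sigma_pt a b = - sigma_pt b a.
Proof. by rewrite /sigma_pt (alt3_23 pA). Qed.

Let etl : lin eta_pt.
Proof. by move=> c u v; rewrite /eta_pt kl; ring. Qed.

(** If [chi] is the real part of a complex (3,0)-form, the right-hand side is its imaginary part up
    to sign. *)
Lemma psi_chi a b c : t * psi V a b c = chi (J a) b c.
Proof.
rewrite (g2_psi G) /chi /eta_pt.
have -> : k (J a) V = 0.
  by have /eqP := acs_unit G f a; rewrite (linZ _ _ (kr _)) mulf_eq0 (negbTE t0) => /eqP.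
have e : phi (C V a) b c = t^-1 * phi (J a) b c.
  have -> : J a = t *: C V a.
    apply: (g2_knondeg G) => z; rewrite (linZ _ _ (kl _)) !(g2_cross G).
    by rewrite (linZ _ _ (alt3_lin pA _ _)).
  by rewrite (linZ _ _ (alt3_lin pA _ _)) mulKf.
have s1 b' : sigma_pt (J a) b' = - t^-1 * (k a b' - t ^+ 2 * k V a * k V b').
  apply: (mulfI t0); rewrite sigE (acs_sqr G f1) (linD _ _ (kl _)) (linN _ (kl _)).
  rewrite !(linZ _ _ (kl _)).
  by field.
rewrite e (sigA c) !s1 !(ks V).
by field.
Qed.

(* First derivatives at a point, the differentiated object being named after the
   letter [d] and [v] standing for [dV].  The first argument is the direction,
   except for [dk] and [dC], which are derivatives along [V].  [Gam] is the
   symbol of a symmetric connection. *)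
Variables (v : W -> W) (dt : W -> R) (dk deta : W -> W -> R).
Variables (dphi : W -> W -> W -> W -> R) (dpsi : W -> W -> W -> W -> W -> R).
Variables (dC dJ Gam : W -> W -> W).

Definition dchi w a b c :=
  dphi w a b c
  - ((dphi w V a b + phi (v w) a b) * eta_pt c + sigma_pt a b * deta w c
   + ((dphi w V b c + phi (v w) b c) * eta_pt a + sigma_pt b c * deta w a)
   + ((dphi w V c a + phi (v w) c a) * eta_pt b + sigma_pt c a * deta w b)).

Definition collinear a := exists c, a = c *: V.

Hypothesis v_lin : forall b, lin (fun a => k (v a) b).
Hypothesis deta_lin : forall w, lin (deta w).
Hypothesis deta_lin1 : forall a, lin (deta ^~ a).
Hypothesis dphi_alt : forall w, alternating3 (dphi w).
Hypothesis d_eta : forall w, deta w V + eta_pt (v w) = 0.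
Hypothesis lie_phi : forall a b c,
  dphi V a b c + phi (v a) b c + phi a (v b) c + phi a b (v c) = 0.
Hypothesis closed_phi : forall a b c d,
  dphi a b c d - dphi b a c d + dphi c a b d - dphi d a b c = 0.
Hypothesis closed_psi : forall a b c d,
  dpsi V a b c d - dpsi a V b c d + dpsi b V a c d - dpsi c V a b d
  + dpsi d V a b c = 0.
Hypothesis lie_k : forall a b, dk a b + k (v a) b + k a (v b) =
  (t ^+ 2)^-1 * ((deta V a + eta_pt (v a)) * eta_pt b + eta_pt a * (deta V b + eta_pt (v b))).
Hypothesis d_cross : forall a b z, dk (C a b) z + k (dC a b) z = dphi V a b z.
Hypothesis d_psi : forall a b c d, dpsi V a b c d
  = dphi V (C a b) c d + phi (dC a b) c d
    - (dk a c * k b d + k a c * dk b d) + (dk a d * k b c + k a d * dk b c).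
Hypothesis d_chiJ : forall w a b c,
  dchi w (J a) b c + chi (dJ w a) b c = dchi w a (J b) c + chi a (dJ w b) c.
Hypothesis d_psi_chi : forall w a b c,
  dt w * psi V a b c + t * (dpsi w V a b c + psi (v w) a b c)
  = dchi w (J a) b c + chi (dJ w a) b c.
Hypothesis GamC : forall a b, Gam a b = Gam b a.
Hypothesis GamV : forall w, collinear (Gam w V - v w).
Hypothesis GamJ : forall w a, collinear (dJ w a + J (Gam w a) - Gam w (J a)).

Lemma chi_collinear a b c : collinear a -> chi a b c = 0.
Proof. by move=> [e ->]; rewrite (linZ _ _ (alt3_lin chA _ _)) chV mulr0. Qed.

Lemma dchi_alt w : alternating3 (dchi w).
Proof.
have dA := dphi_alt w; split=> [b c e x y|a b c|a b c]; rewrite /dchi.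
- rewrite (alt3_lin dA) (alt3_lin2 dA) (alt3_lin3 dA) (alt3_lin2 pA) (alt3_lin3 pA).
  by rewrite /sigma_pt (alt3_lin2 pA) (alt3_lin3 pA) etl deta_lin; ring.
- rewrite /sigma_pt (alt3_12 dA a b c) (alt3_23 dA V a b) (alt3_23 dA V b c).
  rewrite (alt3_23 dA V c a) !(alt3_23 pA _ b a) !(alt3_23 pA _ c b) !(alt3_23 pA _ a c).
  by ring.
- rewrite /sigma_pt (alt3_23 dA a b c) (alt3_23 dA V a b) (alt3_23 dA V b c).
  rewrite (alt3_23 dA V c a) !(alt3_23 pA _ b a) !(alt3_23 pA _ c b) !(alt3_23 pA _ a c).
  by ring.
Qed.

(* [nab] is the covariant derivative of [chi] for a symmetric connection for
   which [V] and [J] are parallel modulo [V]. *)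
Definition nab w a b c :=
  dchi w a b c + chi (Gam w a) b c + chi a (Gam w b) c + chi a b (Gam w c).

Lemma nab_12 w a b c : nab w a b c = - nab w b a c.
Proof.
rewrite /nab (alt3_12 (dchi_alt w)) (alt3_12 chA _ b) (alt3_12 chA a).
by rewrite (alt3_12 chA a b (Gam w c)); ring.
Qed.

Lemma nab_23 w a b c : nab w a b c = - nab w a c b.
Proof.
rewrite /nab (alt3_23 (dchi_alt w)) (alt3_23 chA _ b) (alt3_23 chA a _ c).
by rewrite (alt3_23 chA a b (Gam w c)); ring.
Qed.

(** [J] is parallel modulo [V], which [chi] annihilates; differentiating the type condition on [chi]
    therefore leaves no derivative of [J]. *)
Lemma nab_J12 w a b c : nab w (J a) b c = nab w a (J b) c.
Proof.
have := d_chiJ w a b c.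
have /(chi_collinear b c) := GamJ w a.
rewrite (linB _ _ (alt3_lin chA _ _)) (linD _ _ (alt3_lin chA _ _)) chJ12.
have /(chi_collinear a c) := GamJ w b.
rewrite (linB _ _ (alt3_lin chA _ _)) (linD _ _ (alt3_lin chA _ _)) chJ12.
rewrite (alt3_12 chA _ a) (alt3_12 chA _ (J a)) (alt3_12 chA _ a).
rewrite /nab !chJ12.
by lra.
Qed.

(* [theta = L_V eta] *)
Let theta a := deta V a + eta_pt (v a).

(** By symmetry and [GamV], [Gam V x] equals [v x] modulo [V], so along [V] the covariant derivative
    of [chi] is its Lie derivative. Since [phi] and [sigma] are invariant, only the derivative of
    [eta] remains. *)
Lemma nab_V a b c : nab V a b c =
  - (sigma_pt a b * theta c + sigma_pt b c * theta a + sigma_pt c a * theta b).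
Proof.
have chiG x y z : chi (Gam V x) y z = chi (v x) y z.
  have /(chi_collinear y z) := GamV x; rewrite (linB _ _ (alt3_lin chA _ _)) GamC.
  by move/eqP; rewrite subr_eq0 => /eqP.
have chiG2 x y z : chi x (Gam V y) z = chi x (v y) z.
  by rewrite (alt3_12 chA x) chiG -(alt3_12 chA).
have chiG3 x y z : chi x y (Gam V z) = chi x y (v z).
  by rewrite (alt3_23 chA x) chiG2 -(alt3_23 chA).
have dVV x y : dphi V V x y = - phi (v V) x y - phi V (v x) y - phi V x (v y).
  by have := lie_phi V x y; lra.
have dV : dphi V a b c = - phi (v a) b c - phi a (v b) c - phi a b (v c).
  by have := lie_phi a b c; lra.
rewrite /nab chiG chiG2 chiG3 /dchi !dVV dV /chi /theta /sigma_pt; ring.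
Qed.

(* [L_V chi] has type (3,0)+(0,3), hence vanishes on [(w, J w, u)]. *)
Lemma lie_eta_eq0 a : theta a = 0.
Proof.
have thl : lin theta.
  by move=> c x y; rewrite /theta deta_lin /eta_pt v_lin; ring.
have thh u : k f u = 0 -> theta u = 0.
  move=> u0; have [w [w0 wf [wu _ wJu _]]] := exists_perp G dim_gt5 f u u.
  have key x y z : - (sigma_pt w (J w) * x + sigma_pt (J w) u * y + sigma_pt u w * z) = 0 -> x = 0.
    move=> /(congr1 (fun x => t * x)).
    rewrite mulrN !mulrDr !mulrA !sigE (acs_isometry G f1) wf mul0r subr0.
    rewrite (acs_sqr_hor G f1) // (linN _ (kl _)) wu.
    rewrite (ks _ w) wJu !oppr0 !mul0r mulr0 !addr0 => /eqP.
    by rewrite oppr_eq0 mulf_eq0 (negbTE (kuu_neq0 G w0)) => /eqP.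
  apply: (key _ (theta w) (theta (J w))); rewrite -nab_V.
  by have := nab_12 V w (J w) u; rewrite nab_J12; lra.
have [a' [c [a0 ->]]] := hor_dec G f1 a.
by rewrite (linD _ _ thl) !(linZ _ _ thl) thh // /theta d_eta !mulr0 addr0.
Qed.

(** [lie_k] gives the Lie derivative of [k] along [V] as the symmetric product of [theta] and [eta]
    divided by [t ^+ 2], so it vanishes with [theta]. Invariance of the metric is thus obtained
    without appeal to its being determined by [phi]. *)
Lemma lie_k0 a b : dk a b = - k (v a) b - k a (v b).
Proof. by have := lie_k a b; rewrite -!/(theta _) !lie_eta_eq0; lra. Qed.

Lemma lie_cross a b : dC a b = v (C a b) - C (v a) b - C a (v b).
Proof.
apply: (g2_knondeg G) => z; have := d_cross a b z; rewrite lie_k0.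
rewrite !(linB _ _ (kl _)) !(g2_cross G).
have := lie_phi a b z; lra.
Qed.

Lemma lie_psi a b c d :
  dpsi V a b c d + psi (v a) b c d + psi a (v b) c d + psi a b (v c) d
  + psi a b c (v d) = 0.
Proof.
rewrite d_psi !lie_k0 lie_cross !(g2_psi G) !(linB _ _ (alt3_lin pA _ _)).
have := lie_phi (C a b) c d; rewrite !(ks _ (v _)); lra.
Qed.

Hypothesis GamN : forall w a, Gam w (- a) = - Gam w a.

(* [nab' / t] is the covariant derivative of [chi / t]. *)
Let nab' w a b c := nab w a b c - t^-1 * dt w * chi a b c.

Let nab'_12 w a b c : nab' w a b c = - nab' w b a c.
Proof. by rewrite /nab' nab_12 (alt3_12 chA a); ring. Qed.

Let nab'_23 w a b c : nab' w a b c = - nab' w a c b.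
Proof. by rewrite /nab' nab_23 (alt3_23 chA a); ring. Qed.

Let nab'_J12 w a b c : nab' w (J a) b c = nab' w a (J b) c.
Proof. by rewrite /nab' nab_J12 chJ12. Qed.

Let nab'N w a b c : nab' w (- a) b c = - nab' w a b c.
Proof.
rewrite /nab' /nab GamN (linN _ (alt3_lin (dchi_alt w) _ _)).
by rewrite !(linN _ (alt3_lin chA _ _)); ring.
Qed.

Let nabJJ' w a b : nab' w b (J b) a = 0.
Proof. by have := nab'_J12 w b b a; rewrite nab'_12; lra. Qed.

Let nabJJ w a b : nab' w a b (J b) = 0.
Proof. by rewrite nab'_12 nab'_23 nabJJ' !oppr0. Qed.

(* Covariant derivative of [i_V psi], multiplied by [t]. *)
Let bnab w a b c := t * (dpsi w V a b c + psi (v w) a b c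
  + psi V (Gam w a) b c + psi V a (Gam w b) c + psi V a b (Gam w c)).

(** The derivative of [psi_chi], with [J] parallel modulo [V]. The factor [t] in that identity
    contributes the [dt] term, whence [nab'] in place of [nab]. *)
Let bnabE w a b c : bnab w a b c = nab' w (J a) b c.
Proof.
have /(chi_collinear b c) := GamJ w a.
rewrite (linB _ _ (alt3_lin chA _ _)) (linD _ _ (alt3_lin chA _ _)) => e1.
have e2 : psi V a b c = t^-1 * chi (J a) b c by rewrite -psi_chi mulKf.
have := d_psi_chi w a b c; rewrite e2 => e3.
have e4 := psi_chi (Gam w a) b c.
have e5 := psi_chi a (Gam w b) c.
have e6 := psi_chi a b (Gam w c).
rewrite /nab' /nab /bnab; lra.
Qed.

Let psi_34 a b c d : psi a b c d = - psi a b d c.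
Proof. by rewrite !(g2_psi G) (alt3_23 pA); ring. Qed.

(** Cartan's formula [d (i_V psi) = L_V psi - i_V (d psi)], both terms being zero; for a symmetric
    connection the alternated covariant derivative is the exterior derivative. *)
Let bnab_closed a b c d :
  bnab a b c d - bnab b a c d + bnab c a b d - bnab d a b c = 0.
Proof.
have e1 := closed_psi a b c d; have e2 := lie_psi a b c d.
rewrite (g2_psi_12 G a (v b)) (g2_psi_23 G a b (v c)) (g2_psi_12 G a (v c)) in e2.
rewrite (psi_34 a b c) (g2_psi_23 G a b (v d)) (g2_psi_12 G a (v d)) in e2.
rewrite /bnab (GamC b a) (GamC c a) (GamC d a) (GamC c b) (GamC d b) (GamC d c).
rewrite (g2_psi_23 G V b (Gam a c)) (psi_34 V b c (Gam a d)) (g2_psi_23 G V b (Gam a d)).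
rewrite (psi_34 V a c (Gam b d)).
set l1 := (X in X = 0) in e1; set l2 := (X in X = 0) in e2.
transitivity (t * (l2 - l1)); first by rewrite /l1 /l2; ring.
by rewrite e1 e2 subrr mulr0.
Qed.

(** This is [d (chi / t) = 0] on ([u], [v0], [w], [J w]), where the derivatives along [u] and [v0]
    drop out by [nabJJ]. It follows from [bnab_closed] on ([J u], [v0], [w], [J w]), where the first
    two terms drop out for the same reason. *)
Let nab'_closed u v0 w : k f u = 0 -> k f v0 = 0 -> k f w = 0 ->
  nab' w u v0 (J w) = nab' (J w) u v0 w.
Proof.
move=> u0 v00 w0; have := bnab_closed (J u) v0 w (J w).
rewrite !bnabE !(acs_sqr_hor G f1) // !nab'N nabJJ.
rewrite [nab' v0 u w (J w)]nabJJ; lra.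
Qed.

Hypothesis etaX : eta_pt X = 0.
Hypothesis ham : forall b, sigma_pt X b = - dt b.

Let et_hor a : k f a = 0 -> eta_pt a = 0.
Proof.
by rewrite (linZ _ _ (kl _)) /eta_pt (ks a) expr2 -mulrA => ->; rewrite mulr0.
Qed.

Let dtE a : t * dt a = k X (J a).
Proof.
have := acs_skew G f X a; rewrite -sigE ham; lra.
Qed.

Let dchi_nab a b c d :
  dchi a b c d - dchi b a c d + dchi c a b d - dchi d a b c =
  nab a b c d - nab b a c d + nab c a b d - nab d a b c.
Proof.
rewrite /nab (GamC b a) (GamC c a) (GamC d a) (GamC c b) (GamC d b) (GamC d c).
rewrite (alt3_12 chA b (Gam a c)) -(alt3_cycle chA (Gam a d) b c).
by rewrite (alt3_23 chA a c (Gam b d)); ring.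
Qed.

Let chiJJ a b : chi a b (J b) = 0.
Proof.
have := chJ12 b b a; rewrite (alt3_12 chA (J b)) => e.
by rewrite (alt3_cycle chA); lra.
Qed.

Lemma contraction_exact a b :
  phi X a b = - (dt a * eta_pt b - dt b * eta_pt a) - t * (deta a b - deta b a).
Proof.
pose Om a b := t * (deta a b - deta b a) + chi X a b.
have Om0 : forall a b, Om a b = 0.
  apply: (two_form_eq0 G dim_gt5 f1).
  - move=> y e u w; rewrite /Om deta_lin1 deta_lin (alt3_lin2 chA); ring.
  - by move=> u w; rewrite /Om (alt3_23 chA); ring.
  - move=> u; rewrite /Om (linZ _ _ (deta_lin1 _)) (linZ _ _ (deta_lin _)).
    rewrite (linZ _ _ (alt3_lin2 chA _ _)) (alt3_12 chA) chV.
    have := lie_eta_eq0 u; have := d_eta u; rewrite /theta => e1 e2.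
    have -> : deta V u = - eta_pt (v u) by lra.
    have -> : deta u V = - eta_pt (v u) by lra.
    by ring.
  move=> u y w u0 y0 w0 wu wy wJu wJy.
  have Jwu : k (J w) u = 0 by rewrite (acs_skew G) wJu oppr0.
  have Jwy : k (J w) y = 0 by rewrite (acs_skew G) wJy oppr0.
  have := hpart_perp G f1 X u0 y0 w0 wu wy wJu wJy; rewrite -chiE => perp.
  have := nab'_closed u0 y0 w0; rewrite /nab' => ncl.
  have cl := closed_phi u y w (J w).
  (* On horizontal vectors [eta] vanishes but its derivative does not, so only the terms with [deta]
     separate [phi] from [chi]. *)
  have dch a1 a2 a3 a4 : k f a1 = 0 -> k f a2 = 0 -> k f a3 = 0 -> k f a4 = 0 ->
      dphi a1 a2 a3 a4 = dchi a1 a2 a3 a4 + (sigma_pt a2 a3 * deta a1 a4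
        + sigma_pt a3 a4 * deta a1 a2 + sigma_pt a4 a2 * deta a1 a3).
    by move=> h1 h2 h3 h4; rewrite /dchi !et_hor //; ring.
  rewrite !dch ?(acs_hor G) // in cl.
  have altc := dchi_nab u y w (J w).
  have n1 := nabJJ u y w; have n2 := nabJJ y u w.
  rewrite /nab' chiJJ mulr0 subr0 in n1; rewrite /nab' chiJJ mulr0 subr0 in n2.
  have tI := mulfI t0.
  have s1 : sigma_pt u w = 0 by apply: tI; rewrite sigE (ks _ w) wJu mulr0.
  have s2 : sigma_pt y w = 0 by apply: tI; rewrite sigE (ks _ w) wJy mulr0.
  have s3 : sigma_pt u (J w) = 0.
    by apply: tI; rewrite sigE (acs_isometry G f1) u0 mul0r subr0 (ks u) wu mulr0.
  have s4 : sigma_pt y (J w) = 0.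
    by apply: tI; rewrite sigE (acs_isometry G f1) y0 mul0r subr0 (ks y) wy mulr0.
  have s5 : k w w = t * sigma_pt w (J w).
    by rewrite sigE (acs_isometry G f1) w0 mul0r subr0.
  have d1 := dtE w; have := dtE (J w).
  rewrite (acs_sqr_hor G f1) // (linN _ (kr _)) => d2.
  rewrite -(alt3_cycle chA w) -(alt3_cycle chA (J w)) in ncl.
  rewrite (sigA (J w) u) (sigA (J w) y) (sigA w u) s1 s2 s3 s4 in cl.
  have d1' : dt w = t^-1 * k (J w) X by apply: tI; rewrite d1 mulVKf // ks.
  have d2' : dt (J w) = - t^-1 * k w X.
    by apply: tI; rewrite d2 mulNr mulrN mulVKf // ks.
  rewrite d1' d2' in ncl; rewrite s5 in perp.
  (* [d phi = 0] on ([u], [y], [w], [J w]). Of [sigma /\ d eta] only two terms survive, because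
     [sigma_pt] pairs [u] and [y] to zero with [w] and [J w]. *)
  have S : sigma_pt w (J w) * (deta u y - deta y u) + sigma_pt u y * (deta w (J w) - deta (J w) w)
      = - (nab w u y (J w) - nab (J w) u y w) by lra.
  (* By [ncl] the left-hand side consists of [dt w] and [dt (J w)] times values of [chi]. The
     Hamiltonian condition turns these into the components of [X] along [J w] and [w], which
     [hpart_perp] reassembles into [chi X u y]. *)
  have n3 : nab w u y (J w) - nab (J w) u y w =
      t^-1 * t^-1 * (t * sigma_pt w (J w) * chi X u y) by rewrite perp; lra.
  rewrite s5 -sigE /Om chiJJ.
  transitivity (t * t * (sigma_pt w (J w) * (deta u y - deta y u)
     + sigma_pt u y * (deta w (J w) - deta (J w) w)) + t * sigma_pt w (J w) * chi X u y).
    by ring.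
  by rewrite S n3; field.
have := Om0 a b; rewrite /Om /chi etaX (sigA b X) !ham; lra.
Qed.

End Jets.

(** * Differential calculus *)

Section NearDifferentiable.
Variables (R : numFieldType) (V W : normedModType R).

Lemma near_eq_differentiable (f g : V -> W) (x : V) :
  (\near x, f x = g x) -> differentiable f x -> differentiable g x.
Proof.
move=> fg df; have fgx : f x = g x := nbhs_singleton fg.
have dg : g \o shift x = cst (g x) + 'd f x +o_ 0 id.
  have /eqaddoP fo := diff_locally df.
  apply/eqaddoP => e e0; have := fo e e0; apply: filter_app.
  have : \forall h \near (0 : V), f (h + x) = g (h + x).
    by move: (fg); rewrite (near_shift 0) subr0.
  apply: filter_app; near=> h => fgh.
  by rewrite !fctE /= fgh fgx.
apply/diff_locallyP; rewrite (diff_unique _ dg); last exact: diff_continuous.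
by split=> //; exact: diff_continuous.
Unshelve. all: by end_near. Qed.

End NearDifferentiable.

Section Leibniz.
Variables (R : realType) (V : normedModType R).

(** Leibniz rule for a linear form evaluated on a vector, both varying: in the standard basis the
    value is a finite sum of products. Linearity is assumed only near [x], since tensors are linear
    only inside chart domains. *)
Lemma is_derive_family m (T : V -> 'rV[R]_m -> R) (a : V -> 'rV[R]_m)
    (x w : V) :
  (\forall y \near x, forall c u v, T y (c *: u + v) = c * T y u + T y v) ->
  (forall u, derivable (T ^~ u) x w) -> derivable a x w ->
  is_derive x w (fun y => T y (a y)) ('D_w (T ^~ (a x)) x + T x ('D_w a x)).
Proof.
move=> Tl dT da.
have Tsum : \forall y \near x, forall u, T y u = \sum_i u 0 i * T y (delta_mx 0 i).
  near=> y => u.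
  have Ty : forall c u v, T y (c *: u + v) = c * T y u + T y v by near: y.
  have T0 : T y 0 = 0 by have := Ty (-1) 0 0; rewrite scaler0 addr0 mulN1r addNr.
  rewrite {1}(row_sum_delta u) (big_morph (T y) (id1 := 0) (op1 := +%R)) //.
    by apply: eq_bigr => i _; rewrite -[_ *: _]addr0 Ty T0 addr0.
  by move=> p q; rewrite -[p]scale1r Ty mul1r scale1r.
have dai i : derivable (fun y => a y 0 i) x w by move/derivable_mxP : da; apply.
have Dsum u : 'D_w (T ^~ u) x = \sum_i u 0 i * 'D_w (T ^~ (delta_mx 0 i)) x.
  rewrite (near_eq_derive (g := \sum_i (u 0 i \*: (T ^~ (delta_mx 0 i))))) ; last first.
    near=> y; rewrite fct_sumE; have -> : T y u = \sum_i u 0 i * T y (delta_mx 0 i).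
      by near: y; apply: filterS Tsum.
    by [].
  by rewrite derive_sum => [|i]; [apply: eq_bigr => i _; rewrite deriveZ|exact: derivableZ].
apply: (near_eq_is_derive (f := \sum_i (fun y => a y 0 i * T y (delta_mx 0 i)))).
  near=> y; rewrite fct_sumE; symmetry.
  by have : forall u, T y u = \sum_i u 0 i * T y (delta_mx 0 i) by near: y.
have xsum : forall u, T x u = \sum_i u 0 i * T x (delta_mx 0 i) := nbhs_singleton Tsum.
apply: is_derive_eq.
  apply: is_derive_sum => i; apply: is_deriveM; exact/derivableP.
rewrite Dsum xsum -big_split /=; apply: eq_bigr => i _.
rewrite derive_mx // !mxE; congr (_ + _).
by rewrite mulrC.
Unshelve. all: by end_near. Qed.

End Leibniz.

Section Chain.
Variables (R : realType) (U V W : normedModType R).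

Lemma derive_comp (f : U -> V) (g : V -> W) x w :
  differentiable f x -> differentiable g (f x) ->
  'D_w (fun y => g (f y)) x = 'D_('D_w f x) g (f x).
Proof.
move=> df dg; rewrite !deriveE // -/(g \o f); last exact: differentiable_comp.
by rewrite diff_comp.
Qed.

End Chain.

Section Line.
Variables (R : realType) (V W : normedModType R).

Lemma is_derive_line (f : V -> W) (a u : V) (s : R) :
  differentiable f (a + s *: u) ->
  is_derive s 1 (fun r : R => f (a + r *: u)) ('D_u f (a + s *: u)).
Proof.
move=> df; have dl : is_diff s (fun r : R => a + r *: u) ( *:%R^~ u).
  by apply: is_diff_eq; rewrite add0r.
apply: DeriveDef.
  apply: diff_derivable.
  by apply: (@differentiable_comp _ _ _ _ (fun r : R => a + r *: u) f).
rewrite (@derive_comp R R^o V W (fun r : R => a + r *: u) f s 1) //; congr ('D__ f _).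
by rewrite deriveE // diff_val scale1r.
Qed.

End Line.

(** * Symmetry of second derivatives *)

Section Schwarz.
Variables (R : realType) (V : normedModType R).

(** The mean value theorem twice: along [u] for the difference of [f] on two parallel sides, then
    along [v] for the derivative so obtained. *)
Lemma second_difference (f : V -> R) (x u v : V) (h : R) : 0 < h ->
  (forall s t : R, 0 <= s <= h -> 0 <= t <= h ->
     differentiable f (x + s *: u + t *: v) /\
     differentiable (fun y => 'D_u f y) (x + s *: u + t *: v)) ->
  exists s t : R, [/\ 0 <= s <= h, 0 <= t <= h &
    f (x + h *: u + h *: v) - f (x + h *: u) - f (x + h *: v) + f x
    = 'D_v (fun y => 'D_u f y) (x + s *: u + t *: v) * h * h].
Proof.
move=> h0 df; have hh : 0 <= h <= h by rewrite (ltW h0) lexx.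
have cont (a : R) (g dg : R -> R) : (forall r : R, 0 <= r <= a -> is_derive r 1 g (dg r)) ->
    {within `[0, a], continuous g}.
  move=> dgr; apply: derivable_within_continuous => r; rewrite in_itv /= => ra.
  by have [] := dgr r ra.
have oocc (r : R) : r \in `]0, h[ -> 0 <= r <= h.
  by rewrite in_itv /= => /andP[/ltW-> /ltW->].
have hz : 0 <= (0 : R) <= h by rewrite lexx ltW.
pose p (s : R) := f (x + h *: v + s *: u) - f (x + s *: u).
have dp (s : R) : 0 <= s <= h ->
    is_derive s 1 p ('D_u f (x + h *: v + s *: u) - 'D_u f (x + s *: u)).
  move=> sh; apply: is_deriveB; apply: is_derive_line.
    by have [] := df s h sh hh; rewrite addrAC.
  by have [] := df s 0 sh hz; rewrite scale0r addr0.
have [s sh] := @MVT_segment R p _ 0 h (ltW h0)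
  (fun s hs => dp s (oocc _ hs)) (cont h p _ dp).
rewrite subr0 /p !scale0r !addr0 => e1.
have {}sh : 0 <= s <= h by rewrite in_itv in sh.
pose q (t : R) := 'D_u f (x + s *: u + t *: v).
have dq (t : R) : 0 <= t <= h ->
    is_derive t 1 q ('D_v (fun y => 'D_u f y) (x + s *: u + t *: v)).
  by move=> th; apply: is_derive_line; have [] := df s t sh th.
have [t th] := @MVT_segment R q _ 0 h (ltW h0)
  (fun s hs => dq s (oocc _ hs)) (cont h q _ dq).
have {}th : 0 <= t <= h by rewrite in_itv in th.
rewrite subr0 /q scale0r addr0 => e2; exists s, t; split=> //.
rewrite -e2 [x + s *: u + _]addrAC -e1 (addrAC x (h *: u)); ring.
Qed.


(** The second difference is symmetric in [u] and [v], so the two mixed derivatives agree at two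
    points near [x]; continuity at [x] brings them together. *)
Lemma schwarz (f : V -> R) (x u v : V) :
  (\forall y \near x, differentiable f y) ->
  (\forall y \near x, differentiable (fun z => 'D_u f z) y) ->
  (\forall y \near x, differentiable (fun z => 'D_v f z) y) ->
  {for x, continuous (fun y => 'D_v (fun z => 'D_u f z) y)} ->
  {for x, continuous (fun y => 'D_u (fun z => 'D_v f z) y)} ->
  'D_v (fun z => 'D_u f z) x = 'D_u (fun z => 'D_v f z) x.
Proof.
move=> df du dv cu cv; apply/eqP; rewrite -subr_eq0 -normr_le0.
apply/ler_addgt0Pr => e e0; rewrite add0r.
have e2 : 0 < e / 2 by rewrite divr_gt0.
pose P y := [/\ differentiable f y, differentiable (fun z => 'D_u f z) y,
  differentiable (fun z => 'D_v f z) y,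
  `|'D_v (fun z => 'D_u f z) x - 'D_v (fun z => 'D_u f z) y| <= e / 2 &
  `|'D_u (fun z => 'D_v f z) x - 'D_u (fun z => 'D_v f z) y| <= e / 2].
have nP : \forall y \near x, P y.
  have cu' : \forall y \near x,
      `|'D_v (fun z => 'D_u f z) x - 'D_v (fun z => 'D_u f z) y| <= e / 2.
    exact: cvgr_dist_le cu _ e2.
  have cv' : \forall y \near x,
      `|'D_u (fun z => 'D_v f z) x - 'D_u (fun z => 'D_v f z) y| <= e / 2.
    exact: cvgr_dist_le cv _ e2.
  have FI := @filterI _ (nbhs x) (nbhs_filter x).
  have P1 := FI _ _ (FI _ _ df du) (FI _ _ dv (FI _ _ cu' cv')).
  by apply: (@filterS _ (nbhs x) (nbhs_filter x) _ _ _ P1) => y [[? ?] [? [? ?]]].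
have [r /= r0 rP] := (nbhs_ballP _ _).1 nP.
(* This keeps the parallelogram with sides [h *: u] and [h *: v] inside the ball of radius [r]; the
   summand 1 keeps the denominator positive when [u] and [v] are zero. *)
pose h := r / (2 * (`|u| + `|v| + 1)).
have D0 : 0 < `|u| + `|v| + 1 by rewrite ltr_wpDl // addr_ge0.
have h0 : 0 < h by rewrite divr_gt0 // mulr_gt0.
have hP (s t : R) : 0 <= s <= h -> 0 <= t <= h -> P (x + s *: u + t *: v).
  move=> /andP[s0 sh] /andP[t0 th]; apply: rP; rewrite -ball_normE /=.
  rewrite -addrA opprD addNKr normrN.
  apply: (@le_lt_trans _ _ (h * (`|u| + `|v|))).
    rewrite mulrDr (le_trans (ler_normD _ _)) // !normrZ !ger0_norm //.
    by rewrite lerD // ler_wpM2r.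
  rewrite /h -mulrA gtr_pMr // mulrC ltr_pdivrMr ?mulr_gt0 //.
  have := normr_ge0 u; have := normr_ge0 v; lra.
have [s1 [t1 [s1h t1h d1]]] := @second_difference f x u v h h0
  (fun s t hs ht => let: And5 a b _ _ _ := hP s t hs ht in conj a b).
have [s2 [t2 [s2h t2h d2]]] := @second_difference f x v u h h0
  (fun s t hs ht => let: And5 a _ b _ _ :=
     eq_ind _ P (hP t s ht hs) _ (addrAC _ _ _) in conj a b).
have [_ _ _ b1 _] := hP _ _ s1h t1h.
have [_ _ _ _ b2] := hP _ _ t2h s2h.
rewrite [x + t2 *: u + _]addrAC in b2.
rewrite [x + h *: v + _]addrAC in d2.
move: d1 d2 b1 b2.
move: ('D_v (fun z => 'D_u f z) (x + s1 *: u + t1 *: v)) => A.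
move: ('D_u (fun z => 'D_v f z) (x + s2 *: v + t2 *: u)) => B.
move: ('D_v (fun z => 'D_u f z) x) ('D_u (fun z => 'D_v f z) x) => a b.
move=> d1 d2 b1 b2.
have hn0 : h != 0 by rewrite gt_eqF.
have /(mulIf hn0)/(mulIf hn0) AB : A * h * h = B * h * h.
  by rewrite -d1 -d2; congr (_ + _); exact: addrAC.
by rewrite -(subrKA A) (splitr e) (le_trans (ler_normD _ _)) // lerD // AB distrC.
Qed.

End Schwarz.

(** * Closure properties of functions of class C^k *)

Section CkClosure.
Variables (R : realType) (n : nat).
Implicit Types (U : set 'rV[R]_n) (k : nat).

Section Gen.
Variable W : normedModType R.
Implicit Types f g : 'rV[R]_n -> W.

Lemma open_near_eq U f g x : open U -> U x -> (forall y, U y -> f y = g y) ->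
  \forall y \near x, f y = g y.
Proof. by move=> oU Ux fg; apply: filterS (open_nbhs_nbhs (conj oU Ux)). Qed.

(** On an open set, equality of functions passes to their derivatives. Local expressions are total
    functions for which formulas hold only on chart domains, hence the constant use of this
    transfer. *)
Lemma Ck_on_eq k U f g : open U -> (forall y, U y -> f y = g y) ->
  Ck_on k U f -> Ck_on k U g.
Proof.
move=> oU; elim: k f g => [|k IH] f g fg /=.
  move=> fc x Ux; have fgx := open_near_eq oU Ux fg.
  have fcx : f @ x --> f x := fc x Ux; rewrite (fg x Ux) in fcx.
  exact: cvg_trans (near_eq_cvg fgx) fcx.
move=> [df Df]; split=> [x Ux|v].
  by apply: (near_eq_differentiable (open_near_eq oU Ux fg)); exact: df.
apply: IH (Df v) => y Uy; apply: near_eq_derive; exact: open_near_eq fg.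
Qed.

Lemma Ck_onS k U f : Ck_on k.+1 U f -> Ck_on k U f.
Proof.
elim: k f => [|k IH] f /= [df Df].
  by move=> x Ux; exact/differentiable_continuous/df.
by split=> // v; apply: IH; exact: Df.
Qed.

Lemma Ck_on_sub k U U' f : U' `<=` U -> Ck_on k U f -> Ck_on k U' f.
Proof.
move=> UU'; elim: k f => [|k IH] f /=; first by move=> h x /UU'; exact: h.
by move=> [df Df]; split=> [x /UU'/df//|v]; exact: IH.
Qed.

Lemma Ck_on_cst k U (c : W) : Ck_on k U (fun=> c).
Proof.
elim: k c => [|k IH] c /=; first by move=> x _; exact: cst_continuous.
split=> [x _|v]; first exact: differentiable_cst.
rewrite (_ : (fun x => 'D_v (fun=> c) x) = fun=> 0); last first.
  by apply/funext => x; exact: derive_cst.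
exact: IH.
Qed.

Lemma Ck_onD k U f g : open U ->
  Ck_on k U f -> Ck_on k U g -> Ck_on k U (fun x => f x + g x).
Proof.
move=> oU; elim: k f g => [|k IH] f g /=.
  by move=> fc gc x Ux; exact: (cvgD (fc x Ux) (gc x Ux)).
move=> [df Df] [dg Dg]; split=> [x Ux|v].
  by apply: differentiableD; [exact: df|exact: dg].
apply: (Ck_on_eq oU _ (IH _ _ (Df v) (Dg v))) => y Uy.
by rewrite -deriveD //; apply: diff_derivable; [exact: df|exact: dg].
Qed.

End Gen.

Lemma Ck_onM k U (f g : 'rV[R]_n -> R) : open U ->
  Ck_on k U f -> Ck_on k U g -> Ck_on k U (fun x => f x * g x).
Proof.
move=> oU; elim: k f g => [|k IH] f g.
  by move=> fc gc x Ux; exact: (cvgM (fc x Ux) (gc x Ux)).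
move=> Cf Cg; have Cf' := Ck_onS Cf; have Cg' := Ck_onS Cg.
move: Cf Cg => /= [df Df] [dg Dg]; split=> [x Ux|v].
  by apply: differentiableM; [exact: df|exact: dg].
apply: (Ck_on_eq oU _ (Ck_onD oU (IH _ _ Cf' (Dg v)) (IH _ _ Cg' (Df v)))) => y Uy.
by rewrite -deriveM //; apply: diff_derivable; [exact: df|exact: dg].
Qed.

Lemma Ck_on_sum k U m (f : 'I_m -> 'rV[R]_n -> R) : open U ->
  (forall i, Ck_on k U (f i)) -> Ck_on k U (fun x => \sum_i f i x).
Proof.
move=> oU Cf; elim: (index_enum _) => [|i s IH].
  apply: (Ck_on_eq oU _ (Ck_on_cst k U (0 : R))) => y _; by rewrite big_nil.
by apply: (Ck_on_eq oU _ (Ck_onD oU (Cf i) IH)) => y _; rewrite big_cons.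
Qed.

Lemma differentiable_coordf m (f : 'rV[R]_n -> 'rV[R]_m) j x :
  differentiable f x -> differentiable (fun y => f y 0 j) x.
Proof.
move=> df; apply: (@differentiable_comp _ _ _ _ f (fun M : 'rV[R]_m => M 0 j)) => //.
exact: differentiable_coord.
Qed.

Lemma derive_coordf m (f : 'rV[R]_n -> 'rV[R]_m) j x v :
  differentiable f x -> 'D_v (fun y => f y 0 j) x = ('D_v f x) 0 j.
Proof. by move=> df; rewrite derive_mx ?mxE //; exact: diff_derivable. Qed.

Lemma Ck_on_coord k U m (f : 'rV[R]_n -> 'rV[R]_m) j : open U ->
  Ck_on k U f -> Ck_on k U (fun x => f x 0 j).
Proof.
move=> oU; elim: k f => [|k IH] f /=.
  move=> fc x Ux; apply: (@continuous_comp _ _ _ f (fun M : 'rV[R]_m => M 0 j)).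
    exact: fc.
  exact: coord_continuous.
move=> [df Df]; split=> [x Ux|v]; first exact/differentiable_coordf/df.
by apply: (Ck_on_eq oU _ (IH _ (Df v))) => y Uy; rewrite derive_coordf //; exact: df.
Qed.

(** By the chain rule a derivative of the composite is a sum of coordinates of ['D_v F] times
    partial derivatives of [g] composed with [F], to which the induction hypothesis applies. *)
Lemma Ck_on_comp k U m (U' : set 'rV[R]_m) (F : 'rV[R]_n -> 'rV[R]_m)
    (g : 'rV[R]_m -> R) : open U -> (forall x, U x -> U' (F x)) ->
  smooth_on U F -> Ck_on k U' g -> Ck_on k U (fun x => g (F x)).
Proof.
move=> oU UU' sF; elim: k g => [|k IH] g.
  move=> /= gc x Ux; apply: (@continuous_comp _ _ _ F g); first exact: (sF 0%N).
  exact: gc (UU' _ Ux).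
move=> /= [dg Dg]; split=> [x Ux|v].
  by apply: (@differentiable_comp _ _ _ _ F g); [exact: (sF 1%N).1|exact: dg (UU' _ Ux)].
have C := Ck_on_sum oU (fun a : 'I_m => Ck_onM oU
  (Ck_on_coord a oU ((sF k.+1).2 v)) (IH _ (Dg (delta_mx 0 a)))).
apply: (Ck_on_eq oU _ C) => y Uy.
have dF : differentiable F y by exact: (sF 1%N).1.
have dgy : differentiable g (F y) by exact: dg (UU' _ Uy).
rewrite [RHS](derive_comp v dF dgy) (deriveE _ dgy) [in RHS](row_sum_delta ('D_v F y)).
by rewrite linear_sum; apply: eq_bigr => a _; rewrite linearZ /= (deriveE _ dgy).
Qed.

Lemma Ck_schwarz U (f : 'rV[R]_n -> R) x u v : open U -> U x -> Ck_on 2 U f ->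
  'D_v (fun z => 'D_u f z) x = 'D_u (fun z => 'D_v f z) x.
Proof.
move=> oU Ux /= [df Df].
have nU (P : 'rV[R]_n -> Prop) : (forall y, U y -> P y) -> \forall y \near x, P y.
  by move=> UP; apply: filterS (open_nbhs_nbhs (conj oU Ux)).
apply: schwarz; [exact: nU|exact: nU (Df u).1|exact: nU (Df v).1| |].
  exact: (Df u).2.
exact: (Df v).2.
Qed.

Lemma smooth_schwarz_row U m (f : 'rV[R]_n -> 'rV[R]_m) x u v :
  open U -> U x -> smooth_on U f ->
  'D_v (fun z => 'D_u f z) x = 'D_u (fun z => 'D_v f z) x.
Proof.
move=> oU Ux sf; have [_ Df] := sf 2%N.
have du : differentiable (fun z => 'D_u f z) x := (Df u).1 x Ux.
have dv : differentiable (fun z => 'D_v f z) x := (Df v).1 x Ux.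
apply/rowP => j.
have e w z : 'D_w (fun y => 'D_z f y 0 j) x = 'D_w (fun y => 'D_z (fun y => f y 0 j) y) x.
  apply: near_eq_derive; apply: (open_near_eq oU Ux) => y Uy.
  by rewrite derive_coordf //; exact: (sf 1%N).1.
have s2 : 'D_v (fun z => 'D_u (fun y => f y 0 j) z) x
        = 'D_u (fun z => 'D_v (fun y => f y 0 j) z) x.
  by apply: (Ck_schwarz _ _ oU Ux); exact: (Ck_on_coord j oU (sf 2%N)).
exact: (etrans (esym (derive_coordf j v du)) (etrans (e v u) (etrans s2
  (etrans (esym (e u v)) (derive_coordf j u dv))))).
Qed.

End CkClosure.

(** * Integrable almost complex structures and their connections *)

Section Nijenhuis.
Variables (R : realType) (n : nat) (J : 'rV[R]_n -> 'M[R]_n) (z : 'rV[R]_n).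
Hypothesis Jd : differentiable J z.
Hypothesis J2 : \forall y \near z, J y *m J y = - 1%:M.
Hypothesis J_integrable : forall u v, nijenhuis J z u v = 0.

Definition dacs (w v : 'rV[R]_n) : 'rV[R]_n := 'D_w (fun y => v *m J y) z.

Lemma mulmx_coord_differentiable (v : 'rV[R]_n) c :
  differentiable (fun y => (v *m J y) 0 c) z.
Proof.
rewrite (_ : (fun y => _) = \sum_(a < n) (fun y => v 0 a * J y a c)); last first.
  by apply/funext => y; rewrite mxE fct_sumE.
apply: differentiable_sum => a; apply: (@differentiableM _ _ (fun=> v 0 a)).
  exact: differentiable_cst.
apply: (@differentiable_comp _ _ _ _ J (fun M : 'M[R]_n => M a c)) => //.
exact: differentiable_coord.
Qed.

Lemma mulmx_derivable (v w : 'rV[R]_n) : derivable (fun y => v *m J y) z w.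
Proof.
apply/derivable_mxP => i c; rewrite ord1; apply: diff_derivable.
exact: mulmx_coord_differentiable.
Qed.

Lemma dacsE w v c : dacs w v 0 c = 'd (fun y => (v *m J y) 0 c) z w.
Proof.
rewrite /dacs derive_mx ?mxE; last exact: mulmx_derivable.
by rewrite deriveE //; exact: mulmx_coord_differentiable.
Qed.

Lemma dacs_lin1 e w w' v : dacs (e *: w + w') v = e *: dacs w v + dacs w' v.
Proof. by apply/rowP => c; rewrite !(mxE, dacsE) linearP. Qed.

Lemma dacs_lin2 e w v v' : dacs w (e *: v + v') = e *: dacs w v + dacs w v'.
Proof.
have dv u : is_derive z w (fun y => u *m J y) (dacs w u).
  exact/derivableP/mulmx_derivable.
have h : is_derive z w (e \*: (fun y => v *m J y) + (fun y => v' *m J y))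
    (e *: dacs w v + dacs w v').
  exact: is_deriveD (is_deriveZ e (dv v)) (dv v').
have e1 : (fun y => (e *: v + v') *m J y)
    = e \*: (fun y => v *m J y) + (fun y => v' *m J y).
  by apply/funext => y; rewrite mulmxDl -scalemxAl.
rewrite {1}/dacs e1; exact: (@derive_val _ _ _ _ _ _ _ h).
Qed.

Lemma dacs_anticomm w v : dacs w (v *m J z) = - (dacs w v *m J z).
Proof.
apply/rowP => c.
have h : is_derive z w (fun y => (v *m J y *m J y) 0 c)
    ('D_w (fun y => (v *m J z *m J y) 0 c) z + (dacs w v *m J z) 0 c).
  apply: (@is_derive_family _ _ n (fun y u => (u *m J y) 0 c) (fun y => v *m J y)).
  - by near=> y => e p q; rewrite mulmxDl -scalemxAl !mxE.
  - by move=> u; apply: diff_derivable; exact: mulmx_coord_differentiable.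
  - exact: mulmx_derivable.
have D0 : 'D_w (fun y => (v *m J y *m J y) 0 c) z = 0.
  rewrite (near_eq_derive (g := cst ((- v) 0 c))) ?derive_cst //.
  near=> y; rewrite -mulmxA.
  have -> : J y *m J y = - 1%:M by near: y.
  by rewrite mulmxN mulmx1.
have e : dacs w (v *m J z) 0 c = 'D_w (fun y => (v *m J z *m J y) 0 c) z.
  by rewrite dacsE deriveE //; exact: mulmx_coord_differentiable.
have := @derive_val _ _ _ _ _ _ _ h; rewrite D0 -e => /esym/eqP.
by rewrite addr_eq0 => /eqP ->; rewrite [RHS]mxE.
Unshelve. all: by end_near. Qed.

Lemma dacs_nijenhuis w v :
  dacs (w *m J z) v - dacs (v *m J z) w = (dacs w v - dacs v w) *m J z.
Proof.
have := J_integrable w v; rewrite /nijenhuis /bracket.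
have c0 (a b : 'rV[R]_n) : 'D_a (cst b) z = 0 by exact: derive_cst.
rewrite !c0 !sub0r !subr0 mulNmx opprK mulmxBl -!/(dacs _ _).
rewrite [cst v z]/= [cst w z]/=.
move: (dacs (w *m J z) v) (dacs (v *m J z) w) (dacs v w *m J z) (dacs w v *m J z).
move=> a b c d /rowP e; apply/rowP => i; have := e i; rewrite !mxE; lra.
Qed.

End Nijenhuis.

Section AcsConnection.
Variables (R : realType) (n : nat) (J : 'M[R]_n).
Variable A : 'rV[R]_n -> 'rV[R]_n -> 'rV[R]_n.
Hypothesis JJ : J *m J = - 1%:M.
Hypothesis A_lin1 : forall e w w' v, A (e *: w + w') v = e *: A w v + A w' v.
Hypothesis A_lin2 : forall e w v v', A w (e *: v + v') = e *: A w v + A w v'.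
Hypothesis A_anticomm : forall w v, A w (v *m J) = - (A w v *m J).
Hypothesis A_nijenhuis : forall w v,
  A (w *m J) v - A (v *m J) w = (A w v - A v w) *m J.

(* Christoffel symbols of a torsion-free connection for which [J] is parallel. *)
Definition acs_gamma (w v : 'rV[R]_n) : 'rV[R]_n :=
  (3 / 8) *: ((A w v + A v w) *m J) + 8^-1 *: (A (w *m J) v + A (v *m J) w).

Lemma acs_gammaC w v : acs_gamma w v = acs_gamma v w.
Proof. by rewrite /acs_gamma [A w v + _]addrC [A (w *m _) _ + _]addrC. Qed.

Lemma acs_gamma_lin e w w' v :
  acs_gamma (e *: w + w') v = e *: acs_gamma w v + acs_gamma w' v.
Proof.
rewrite /acs_gamma !mulmxDl -!scalemxAl !A_lin1 !A_lin2 !mulmxDl -!scalemxAl.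
move: (A w v *m J) (A w' v *m J) (A v w *m J) (A v w' *m J).
move: (A (w *m J) v) (A (w' *m J) v) (A (v *m J) w) (A (v *m J) w').
by move=> a1 a2 a3 a4 a5 a6 a7 a8; apply/rowP => c; rewrite !mxE; ring.
Qed.

(** Parallelism of [J] for the connection [D_w v - acs_gamma w v]. With the weights 3/8 and 1/8,
    anticommutation reduces the right-hand side to 3/4 of [A w v], plus 1/4 of [A v w], plus 1/4 of
    [(A (v *m J) w - A (w *m J) v) *m J]. The Nijenhuis identity makes the last bracketed product
    equal to [A w v - A v w]. *)
Lemma acs_gammaJ w v : A w v = acs_gamma w (v *m J) - acs_gamma w v *m J.
Proof.
have JJv (u : 'rV[R]_n) : u *m J *m J = - u by rewrite -mulmxA JJ mulmxN mulmx1.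
have AN a b : A (- a) b = - A a b.
  have A0 : A 0 b = 0.
    have := A_lin1 1 0 0 b; rewrite !scale1r addr0 => /esym/eqP.
    by rewrite -subr_eq0 addrK => /eqP.
  by rewrite -scaleN1r -[_ *: a]addr0 A_lin1 A0 addr0 scaleN1r.
rewrite /acs_gamma !JJv AN !A_anticomm !mulmxDl -!scalemxAl !mulmxDl !mulNmx !JJv.
have := A_nijenhuis w v => /(congr1 (mulmx^~ J)).
rewrite !mulmxBl !JJv.
move: (A w v) (A v w) => a b.
move: (A (w *m J) v *m J) (A (v *m J) w *m J) => p q /rowP e.
by apply/rowP => c; have := e c; rewrite !mxE; lra.
Qed.

End AcsConnection.

Section DerivableMatrix.
Variables (R : realType) (V : normedModType R).

Lemma derivable_bigsum (I : Type) (s : seq I) (f : I -> V -> R) x w :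
  (forall i, derivable (f i) x w) -> derivable (fun y => \sum_(i <- s) f i y) x w.
Proof.
move=> df; elim: s => [|i s IH].
  rewrite (_ : (fun y => _) = cst 0); first exact: derivable_cst.
  by apply/funext => y; rewrite big_nil.
rewrite (_ : (fun y => _) = f i + (fun y => \sum_(i <- s) f i y)).
  exact: derivableD.
by apply/funext => y; rewrite big_cons.
Qed.

Lemma derivable_bigprod (I : Type) (s : seq I) (f : I -> V -> R) x w :
  (forall i, derivable (f i) x w) -> derivable (fun y => \prod_(i <- s) f i y) x w.
Proof.
move=> df; elim: s => [|i s IH].
  rewrite (_ : (fun y => _) = cst 1); first exact: derivable_cst.
  by apply/funext => y; rewrite big_nil.
rewrite (_ : (fun y => _) = f i * (fun y => \prod_(i <- s) f i y)).
  exact: derivableM.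
by apply/funext => y; rewrite big_cons.
Qed.

Lemma derivable_det n (M : V -> 'M[R]_n) x w :
  (forall i j, derivable (fun y => M y i j) x w) ->
  derivable (fun y => \det (M y)) x w.
Proof.
move=> dM; apply: derivable_bigsum => s.
apply: (@derivableM _ _ (fun=> (-1) ^+ s)); first exact: derivable_cst.
exact: derivable_bigprod.
Qed.

(** Cramer's rule, valid near [x], makes the entries of the inverse quotients of polynomials; the
    row vector is included to match [cross_of]. *)
Lemma derivable_mul_invmx n (r : V -> 'rV[R]_n) (M : V -> 'M[R]_n) x w :
  (forall i, derivable (fun y => r y 0 i) x w) ->
  (forall i j, derivable (fun y => M y i j) x w) ->
  (\forall y \near x, M y \in unitmx) ->
  derivable (fun y => r y *m invmx (M y)) x w.
Proof.
move=> dr dM uM; apply/derivable_mxP => a c; rewrite ord1.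
apply: (@near_eq_derivable _ _ _
  (fun y => \sum_i r y 0 i * ((\det (M y))^-1 * cofactor (M y) c i))).
  apply: filterS uM => y uMy; rewrite mxE; apply: eq_bigr => i _.
  by rewrite /invmx uMy !mxE.
apply: derivable_bigsum => i; apply: (@derivableM _ _ (fun y => r y 0 i)) => //.
apply: (@derivableM _ _ (fun y => (\det (M y))^-1) (fun y => cofactor (M y) c i)).
  apply: derivableV; last exact: derivable_det.
  by have := nbhs_singleton uM; rewrite unitmxE unitfE.
apply: (@derivableM _ _ (fun=> (-1) ^+ (c + i))); first exact: derivable_cst.
apply: derivable_det => p q.
by rewrite (_ : (fun y => _) = fun y => M y (lift c p) (lift i q)) //;
  apply/funext => y; rewrite !mxE.
Qed.

End DerivableMatrix.

(** * Tensors and their derivatives on tuples of vectors *)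

Section Tensors.
Variables (R : realType) (n : nat).

Lemma multilinear_lin k (f : 'M[R]_(k.+1, n) -> R) (B : 'M[R]_(k, n)) :
  multilinear f -> lin (fun u : 'rV[R]_n => f (col_mx u B)).
Proof.
move=> fm c u v /=.
have r0 (w : 'rV[R]_n) : row 0 (col_mx w B : 'M_(k.+1, n)) = w.
  apply/rowP => q; rewrite mxE mxE; case: splitP => // p _; by rewrite ord1.
have r0' (w : 'rV[R]_n) : row' 0 (col_mx w B : 'M_(k.+1, n)) = B.
  apply/matrixP => p q; rewrite mxE mxE; case: splitP => [a|a] /=.
    by rewrite ord1.
  by rewrite /bump /= => /eqP; rewrite eqSS => /eqP/val_inj ->.
by rewrite (fm 0 _ (col_mx u B) (col_mx v B) c 1) ?mul1r // !(r0, r0') ?scale1r.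
Qed.

End Tensors.

Section LocalFormulas.
Variables (R : realType) (n : nat).
Implicit Types a b c d e : 'rV[R]_n.

Lemma ext_d3E (w : 'rV[R]_n -> 'M[R]_(3, n) -> R) x a b c d :
  ext_d w x (mx4 a b c d) =
  'D_a (fun y => w y (mx3 b c d)) x - 'D_b (fun y => w y (mx3 a c d)) x
  + 'D_c (fun y => w y (mx3 a b d)) x - 'D_d (fun y => w y (mx3 a b c)) x.
Proof.
have rE (r : 'I_4) : row r (mx4 a b c d) = nth a [:: a; b; c; d] r.
  by apply/rowP => q; rewrite mxE mx4E; case: r => [[|[|[|[|]]]]].
have r'E (r : 'I_4) : row' r (mx4 a b c d) =
    nth (mx3 b c d) [:: mx3 b c d; mx3 a c d; mx3 a b d; mx3 a b c] r.
  apply/matrixP => p q; rewrite mxE mx4E.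
  case: r => [[|[|[|[|//]]]]] r4 /=; rewrite mx3E;
  by case: p => [[|[|[|//]]]].
rewrite /ext_d !big_ord_recl big_ord0 !rE !r'E /=.
rewrite /bump /= expr0 expr1 mul1r mulN1r !exprS expr0; ring.
Qed.

Lemma ext_d4E (w : 'rV[R]_n -> 'M[R]_(4, n) -> R) x a b c d e :
  ext_d w x (mx5 a b c d e) =
  'D_a (fun y => w y (mx4 b c d e)) x - 'D_b (fun y => w y (mx4 a c d e)) x
  + 'D_c (fun y => w y (mx4 a b d e)) x - 'D_d (fun y => w y (mx4 a b c e)) x
  + 'D_e (fun y => w y (mx4 a b c d)) x.
Proof.
have rE (r : 'I_5) : row r (mx5 a b c d e) = nth a [:: a; b; c; d; e] r.
  by apply/rowP => q; rewrite mxE mx5E; case: r => [[|[|[|[|[|]]]]]].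
have r'E (r : 'I_5) : row' r (mx5 a b c d e) = nth (mx4 b c d e)
    [:: mx4 b c d e; mx4 a c d e; mx4 a b d e; mx4 a b c e; mx4 a b c d] r.
  apply/matrixP => p q; rewrite mxE mx5E.
  case: r => [[|[|[|[|[|//]]]]]] r5 /=; rewrite mx4E;
  by case: p => [[|[|[|[|//]]]]].
rewrite /ext_d !big_ord_recl big_ord0 !rE !r'E /=.
rewrite /bump /= expr0 expr1 mul1r mulN1r !exprS expr0; ring.
Qed.

Lemma lie_deriv3E (X : 'rV[R]_n -> 'rV[R]_n) (w : 'rV[R]_n -> 'M[R]_(3, n) -> R)
    x a b c :
  lie_deriv X w x (mx3 a b c) =
  'D_(X x) (fun y => w y (mx3 a b c)) x + w x (mx3 ('D_a X x) b c)
  + w x (mx3 a ('D_b X x) c) + w x (mx3 a b ('D_c X x)).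
Proof.
have rE (r : 'I_3) : row r (mx3 a b c) = nth a [:: a; b; c] r.
  by apply/rowP => q; rewrite mxE mx3E; case: r => [[|[|[|]]]].
have sE (r : 'I_3) u : set_row r u (mx3 a b c) =
    nth (mx3 u b c) [:: mx3 u b c; mx3 a u c; mx3 a b u] r.
  apply/matrixP => p q; rewrite mxE mx3E.
  case: r => [[|[|[|//]]]] r3 /=; rewrite mx3E;
  by case: p => [[|[|[|//]]]].
by rewrite /lie_deriv !big_ord_recl big_ord0 !rE !sE /= addr0 !addrA.
Qed.

End LocalFormulas.

(** * The reduction in charts *)

Section Curried.
Variables (R : realType) (n : nat).

Definition ev2 (w : 'rV[R]_n -> 'M[R]_(2, n) -> R) y u v := w y (mx2 u v).
Definition ev3 (w : 'rV[R]_n -> 'M[R]_(3, n) -> R) y a b c := w y (mx3 a b c).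
Definition ev4 (w : 'rV[R]_n -> 'M[R]_(4, n) -> R) y a b c d := w y (mx4 a b c d).

End Curried.

Section G2Manifold.
Variables (R : realType) (Y : manifold R 7) (phi : dform Y 3) (psi : dform Y 4).
Variables (k : tensor Y 2) (V : vfield Y).
Hypothesis phi_adm : admissible phi.
Hypothesis psi_dual : is_g2_hodge_dual phi psi.
Hypothesis k_metric : is_g2_metric phi k.
Hypothesis V_neq0 : nowhere_vanishing V.
Variable i : idx Y.

Local Notation K := (ev2 (k i)).
Local Notation Ph := (ev3 (phi i)).
Local Notation Ps := (ev4 (psi i)).

Definition crossY y a b := cross_of (K y) (Ph y) a b.
Local Notation Cf := crossY.

Lemma ev2_coframe y E : cod i y -> adapted_coframe phi i y E ->
  K y = fun u v => coframe_metric E (mx2 u v).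
Proof.
move=> iy adE; apply/funext => u; apply/funext => v.
by rewrite /ev2 (k_metric _ iy adE).
Qed.

Lemma ev3_coframe y E : cod i y -> adapted_coframe phi i y E ->
  Ph y = fun a b c => phi0 (mx3 a b c *m E).
Proof.
move=> iy [_ adE]; apply/funext => a; apply/funext => b; apply/funext => c.
by rewrite /ev3 adE.
Qed.

(** The coframe is chosen at [y] alone and does not occur in the conclusion, so the resulting
    identities can be differentiated in [y]. *)
Lemma g2_point_chart y : cod i y -> g2_point (K y) (Ph y) (Ps y) (Cf y).
Proof.
move=> iy; have [E adE] := phi_adm iy; have [uE phiE] := adE.
have -> : Cf y = fun a b => cross0 (a *m E) (b *m E) *m invmx E.
  apply/funext => a; apply/funext => b.
  by rewrite /crossY (ev2_coframe iy adE) (ev3_coframe iy adE) coframe_cross.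
have -> : Ps y = fun a b c d =>
    @coframe_hodge R 3 4 E (fun A => phi0 (A *m E)) (mx4 a b c d).
  apply/funext => a; apply/funext => b; apply/funext => c; apply/funext => d.
  rewrite /ev4 (psi_dual _ iy adE); congr (coframe_hodge _ _ _).
  by apply/funext => A; rewrite phiE.
by rewrite (ev2_coframe iy adE) (ev3_coframe iy adE); exact: coframe_g2_point.
Qed.

Lemma gram_unit_chart y : cod i y ->
  \matrix_(a, b) K y (delta_mx 0 a) (delta_mx 0 b) \in unitmx.
Proof.
move=> iy; have [E adE] := phi_adm iy; have [uE phiE] := adE.
by rewrite (ev2_coframe iy adE); exact: coframe_gram_unit.
Qed.

Lemma dim_chart y : cod i y -> forall a b c d e, exists w,
  [/\ w != 0, K y w a = 0, K y w b = 0, K y w c = 0 & K y w d = 0 /\ K y w e = 0].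
Proof.
move=> iy; have [E adE] := phi_adm iy.
by rewrite (ev2_coframe iy adE); exact: coframe_dim.
Qed.

Local Notation tau := (tY V k i).

Lemma kVV_gt0 y : cod i y -> 0 < K y (V i y) (V i y).
Proof.
move=> iy; have G := g2_point_chart iy.
rewrite lt_neqAle eq_sym (kuu_neq0 G) ?V_neq0 //=.
have [E adE] := phi_adm iy; rewrite (ev2_coframe iy adE) coframe_metricE.
rewrite /dot mxE; apply: sumr_ge0 => c _; by rewrite [_^T _ _]mxE -expr2 sqr_ge0.
Qed.

Lemma tY_gt0 y : cod i y -> 0 < tau y.
Proof. by move=> iy; rewrite /tY invr_gt0 sqrtr_gt0; exact: kVV_gt0. Qed.

Lemma tY_kVV y : cod i y -> tau y ^+ 2 * K y (V i y) (V i y) = 1.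
Proof.
move=> iy; have q0 := kVV_gt0 iy.
by rewrite /tY exprVn sqr_sqrtr ?ltW // mulVf // gt_eqF.
Qed.

Lemma k_unit y : cod i y -> K y (tau y *: V i y) (tau y *: V i y) = 1.
Proof.
move=> iy; have G := g2_point_chart iy.
rewrite (linZ _ _ (g2_klin G _)) (linZ _ _ (g2_klinr G _)) mulrA -expr2.
exact: tY_kVV.
Qed.

Lemma etaE y v : cod i y -> Defs.eta V k i y v = eta_pt (K y) (V i y) (tau y) v.
Proof.
move=> iy; have G := g2_point_chart iy.
by rewrite /Defs.eta -/(mx2 _ _) -/(ev2 _ _ _ _) (linZ _ _ (g2_klinr G _)).
Qed.

Lemma et_V y : cod i y -> eta_pt (K y) (V i y) (tau y) (V i y) = 1.
Proof. exact: tY_kVV. Qed.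

End G2Manifold.

Section Projection.
Variables (R : realType) (Y : manifold R 7) (N : manifold R 6) (pr : Y -> N).
Hypothesis pr_smooth : smooth_map pr.
Variables (i : idx Y) (j : idx N).
Local Notation F := (loc pr i j).

Lemma loc_dom_open : open (loc_dom pr i j).
Proof.
rewrite openE => x [ix jx]; apply: filterI.
  by apply: open_nbhs_nbhs; split; [exact: cod_open|].
have c : {for x, continuous (pr \o param i)}.
  apply: continuous_comp; first exact: param_continuous.
  exact: pr_smooth.1.
by apply: c; apply: open_nbhs_nbhs; split; [exact: dom_open|].
Qed.

Lemma loc_smooth : smooth_on (loc_dom pr i j) F.
Proof. exact: pr_smooth.2. Qed.

Lemma loc_cod y : loc_dom pr i j y -> cod j (F y).
Proof. by move=> [_ jy]; exists (pr (param i y)). Qed.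

Lemma param_loc y : loc_dom pr i j y -> param j (F y) = pr (param i y).
Proof. by move=> [_ jy]; exact: chartK. Qed.

Lemma loc_differentiable y : loc_dom pr i j y -> differentiable F y.
Proof. exact: (loc_smooth 1%N).1. Qed.

Lemma loc_jacobian y u : loc_dom pr i j y -> u *m jacobian F y = 'D_u F y.
Proof. by move=> /loc_differentiable dF; rewrite deriveEjacobian. Qed.

End Projection.

(** * The structure induced on the orbit space *)

Section QuotientAcs.
Variables (R : realType) (Y : manifold R 7) (phi : dform Y 3) (psi : dform Y 4).
Variables (k : tensor Y 2) (V : vfield Y).
Hypothesis phi_adm : admissible phi.
Hypothesis psi_dual : is_g2_hodge_dual phi psi.
Hypothesis k_metric : is_g2_metric phi k.
Hypothesis V_neq0 : nowhere_vanishing V.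
Variables (N : manifold R 6) (pr : Y -> N) (t : N -> R) (kN : tensor N 2).
Variables (sigma : dform N 2) (J : endofield N).
Hypothesis orb : is_orbit_space V pr.
Hypothesis t_desc : descends_t V pr k t.
Hypothesis kN_quot : is_quotient_metric V pr k kN.
Hypothesis sigma_desc : descends_sigma V pr phi sigma.
Hypothesis J_ind : is_induced_acs t kN sigma J.

Section Chart.
Variables (i : idx Y) (j : idx N) (y : 'rV[R]_7).
Hypothesis Oy : loc_dom pr i j y.

Let iy : cod i y. Proof. by have [] := Oy. Qed.

Local Notation F := (loc pr i j).
Local Notation DF := (jacobian F y).
Local Notation K := (ev2 (k i) y).
Local Notation Ph := (ev3 (phi i) y).
Local Notation V0 := (V i y).
Local Notation t0 := (tY V k i y).
Local Notation f := (t0 *: V0).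
Local Notation C := (crossY phi k i y).
Local Notation E := (eta_pt K V0 t0).

Let G := g2_point_chart phi_adm psi_dual k_metric iy.
Let f1 := k_unit phi_adm psi_dual k_metric V_neq0 iy.

Lemma V_jacobian : V0 *m DF = 0.
Proof. by have [_ _ _ h _] := orb; exact: h. Qed.

(** A right inverse of the differential of the submersion. Its lifts need not be horizontal; they
    are determined modulo [V]. *)
Definition lift_mx : 'M[R]_(6, 7) := pinvmx DF.

Lemma lift_mxK : lift_mx *m DF = 1%:M.
Proof. by have [_ sub _ _ _] := orb; exact: mulVpmx (sub _ _ _ Oy). Qed.

Lemma t_loc : t (param j (F y)) = t0.
Proof.
by have [_ ht] := t_desc; rewrite (param_loc Oy) ht.
Qed.

Lemma t0_gt0 : 0 < t0.
Proof. exact: (tY_gt0 phi_adm psi_dual k_metric V_neq0). Qed.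

Lemma quotientE u v : K u v =
  ev2 (kN j) (F y) (u *m DF) (v *m DF) + (t0 ^+ 2)^-1 * (E u * E v).
Proof.
rewrite /ev2 -mx2M -!(etaE V phi_adm psi_dual k_metric) //.
exact: kN_quot.
Qed.

Lemma kN_lin v : lin (fun u => ev2 (kN j) (F y) u v).
Proof.
apply: (@multilinear_lin R 6 1 (kN j (F y)) v).
by apply: tensor_multilinear; exact: loc_cod.
Qed.

Lemma vertical_eq0 u : u *m DF = 0 -> E u = 0 -> u = 0.
Proof.
move=> u0 Eu; apply: (g2_kdef G).
by rewrite quotientE u0 Eu (lin0 (kN_lin _)); ring.
Qed.

(** In place of a dimension count: once its multiple of [V0] is removed, [u] is killed by both the
    projection and [eta], so it has length zero. *)
Lemma vertical u : u *m DF = 0 -> collinear V0 u.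
Proof.
move=> u0; exists (E u); apply/eqP; rewrite -subr_eq0; apply/eqP.
have El : lin E by move=> c a b; rewrite /eta_pt (g2_klin G); ring.
apply: vertical_eq0; first by rewrite mulmxBl -scalemxAl u0 V_jacobian scaler0 subrr.
by rewrite (linB _ _ El) (linZ _ _ El) (et_V phi_adm psi_dual k_metric V_neq0) // mulr1 subrr.
Qed.

Lemma kN_nondeg d : (forall b, ev2 (kN j) (F y) d (b *m DF) = 0) -> d = 0.
Proof.
move=> d0; have El : lin E by move=> c a b; rewrite /eta_pt (g2_klin G); ring.
pose e := d *m lift_mx - E (d *m lift_mx) *: V0.
have eDF : e *m DF = d.
  by rewrite mulmxBl -scalemxAl V_jacobian scaler0 subr0 -mulmxA lift_mxK mulmx1.
have e0 : E e = 0.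
  by rewrite (linB _ _ El) (linZ _ _ El) (et_V phi_adm psi_dual k_metric V_neq0) // mulr1 subrr.
have : e = 0 by apply: (g2_kdef G); rewrite quotientE eDF -[X in ev2 _ _ d X]eDF d0 e0; ring.
by rewrite -eDF => ->; rewrite mul0mx.
Qed.

Lemma sigma_loc a b : ev3 (phi i) y V0 a b = sigma j (F y) (mx2 (a *m DF) (b *m DF)).
Proof. by rewrite -mx2M; exact: sigma_desc. Qed.

(** Tested against projected vectors, both sides give [t0] times [sigma]: on the left [t0] is the
    length factor in [f], on the right the conformal factor between [kN] and [h]. *)
Lemma acs_jacobian a : C f a *m DF = a *m DF *m J j (F y).
Proof.
apply/eqP; rewrite -subr_eq0; apply/eqP/kN_nondeg => b.
rewrite (linB _ _ (kN_lin _)); apply/eqP; rewrite subr_eq0; apply/eqP.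
transitivity (t0 * ev3 (phi i) y V0 a b).
  have := quotientE (C f a) b.
  have -> : E (C f a) = 0.
    rewrite /eta_pt; have /eqP := acs_unit G f a.
    rewrite (linZ _ _ (g2_klinr G _)) mulf_eq0 gt_eqF ?t0_gt0 //= => /eqP ->.
    by rewrite mulr0.
  rewrite mul0r mulr0 addr0 => <-.
  by rewrite (g2_cross G) (linZ _ _ (alt3_lin (g2_alt G) _ _)).
rewrite sigma_loc -(J_ind _ _ (loc_cod Oy)) /hN t_loc mulrA divff ?mul1r //.
by rewrite gt_eqF ?t0_gt0.
Qed.

Lemma acs_sqr_loc : J j (F y) *m J j (F y) = - 1%:M.
Proof.
apply/row_matrixP => r; rewrite !rowE.
have [a ->] : exists a, delta_mx 0 r = a *m DF :> 'rV_6.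
  by exists (delta_mx 0 r *m lift_mx); rewrite -mulmxA lift_mxK mulmx1.
rewrite mulmxA -!acs_jacobian (acs_sqr G f1) mulmxDl mulNmx -!scalemxAl.
by rewrite V_jacobian !scaler0 addr0 mulmxN mulmx1.
Qed.

End Chart.

(** Surjectivity of [pr] spreads the identity over a whole chart of [N], an open set on which it can
    be differentiated. *)
Lemma acs_sqr_cod j z : cod j z -> J j z *m J j z = - 1%:M.
Proof.
move=> [q jq <-]; have [_ _ sur _ _] := orb; have [p prp] := sur q.
have [i ip] := dom_cover p.
have pK : param i (chart i p) = p by exact: chartK.
have Oy : loc_dom pr i j (chart i p).
  by split; [exists p|rewrite /= pK prp].
by have := acs_sqr_loc Oy; rewrite /loc pK prp.
Qed.

(** * First-order jets of the structure in a pair of charts *)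

Section Jets.
Variables (i : idx Y) (j : idx N) (x : 'rV[R]_7).
Hypothesis Ox : loc_dom pr i j x.
Local Notation W := 'rV[R]_7.
Local Notation F := (loc pr i j).
Local Notation DF y := (jacobian F y).
Local Notation K := (ev2 (k i)).
Local Notation Ph := (ev3 (phi i)).
Local Notation Ps := (ev4 (psi i)).
Local Notation Vf := (V i).
Local Notation tau := (tY V k i).
Local Notation C := (crossY phi k i).
Local Notation E := (fun y => eta_pt (K y) (Vf y) (tau y)).
Local Notation Chi := (fun y => chi (K y) (Ph y) (Vf y) (tau y)).
Local Notation Jh := (fun y => C y (tau y *: Vf y)).

Variables (dV : W -> W) (dtau : W -> R) (dK : W -> W -> W -> R).
Variables (dPh : W -> W -> W -> W -> R) (dPs : W -> W -> W -> W -> W -> R).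
Variables (dE : W -> W -> R) (D2 : W -> W -> 'rV[R]_6).
Variables (dkN : W -> 'rV[R]_6 -> 'rV[R]_6 -> R).
Variable A : 'rV[R]_6 -> 'rV[R]_6 -> 'rV[R]_6.
Variables (dC dJ : W -> W -> W).

Hypothesis isV : forall w, is_derive x w Vf (dV w).
Hypothesis istau : forall w, is_derive x w tau (dtau w).
Hypothesis isK : forall w a b, is_derive x w (fun y => K y a b) (dK w a b).
Hypothesis isPh : forall w a b c, is_derive x w (fun y => Ph y a b c) (dPh w a b c).
Hypothesis isPs : forall w a b c d,
  is_derive x w (fun y => Ps y a b c d) (dPs w a b c d).
Hypothesis isE : forall w a, is_derive x w (fun y => E y a) (dE w a).
Hypothesis isDF : forall w a, is_derive x w (fun y => a *m DF y) (D2 w a).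
Hypothesis iskN : forall w p q,
  is_derive x w (fun y => ev2 (kN j) (F y) p q) (dkN w p q).
Hypothesis isJ : forall w u,
  is_derive x w (fun y => u *m J j (F y)) (A (w *m DF x) u).
Hypothesis isC : forall a b, is_derive x (Vf x) (fun y => C y a b) (dC a b).
Hypothesis isJh : forall w a, is_derive x w (fun y => Jh y a) (dJ w a).

Hypothesis dV_lin : forall e a b, dV (e *: a + b) = e *: dV a + dV b.
Hypothesis dE_lin1 : forall a, lin (dE ^~ a).
Hypothesis D2C : forall a b, D2 a b = D2 b a.
Hypothesis dkNV : forall p q, dkN (Vf x) p q = 0.
Hypothesis dtauV : dtau (Vf x) = 0.
Hypothesis A_lin1 : forall e w w' v, A (e *: w + w') v = e *: A w v + A w' v.
Hypothesis A_lin2 : forall e w v v', A w (e *: v + v') = e *: A w v + A w v'.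
Hypothesis A_anticomm : forall w v, A w (v *m J j (F x)) = - (A w v *m J j (F x)).
Hypothesis A_nijenhuis : forall w v,
  A (w *m J j (F x)) v - A (v *m J j (F x)) w = (A w v - A v w) *m J j (F x).

Let ix : cod i x. Proof. by have [] := Ox. Qed.
Let Gy y (Oy : loc_dom pr i j y) :=
  g2_point_chart phi_adm psi_dual k_metric Oy.1.
Let G := Gy Ox.
Let f1y y (Oy : loc_dom pr i j y) :=
  k_unit phi_adm psi_dual k_metric V_neq0 Oy.1.
Let t0y y (Oy : loc_dom pr i j y) : tau y != 0.
Proof. by rewrite gt_eqF //; exact: (t0_gt0 Oy). Qed.
Let nearO (P : W -> Prop) : (forall y, loc_dom pr i j y -> P y) ->
  \forall y \near x, P y.
Proof.
have [spr _ _ _ _] := orb; have Oo := loc_dom_open spr (i := i) (j := j).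
by move=> OP; apply: (filterS OP); exact: open_nbhs_nbhs.
Qed.

Let derive_uniq (f g : W -> R) w df dg : (forall y, loc_dom pr i j y -> f y = g y) ->
  is_derive x w f df -> is_derive x w g dg -> df = dg.
Proof.
move=> fg [_ <-] [_ <-]; apply: near_eq_derive; exact: nearO.
Qed.

Let fam n (T : W -> 'rV[R]_n -> R) (a : W -> 'rV[R]_n) w dT da :
  (forall y, loc_dom pr i j y -> lin (T y)) ->
  (forall u, is_derive x w (T ^~ u) (dT u)) -> is_derive x w a da ->
  is_derive x w (fun y => T y (a y)) (dT (a x) + T x da).
Proof.
move=> Tl isT [ada <-].
have isTd u : derivable (T ^~ u) x w by have [] := isT u.
have -> : dT (a x) = 'D_w (T ^~ (a x)) x by have [_ <-] := isT (a x).
by apply: is_derive_family => //; exact: nearO.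
Qed.

Let coord n (a : W -> 'rV[R]_n) w da c :
  is_derive x w a da -> is_derive x w (fun y => a y 0 c) (da 0 c).
Proof.
move=> [ada <-]; rewrite derive_mx // mxE; apply: derivableP.
by move/derivable_mxP : ada; apply.
Qed.

Let el y (Oy : loc_dom pr i j y) : lin (E y).
Proof. by move=> c u v; rewrite /eta_pt (g2_klin (Gy Oy)); ring. Qed.

Lemma jet_eta w : dE w (Vf x) + E x (dV w) = 0.
Proof.
apply: (@derive_uniq (fun y => E y (Vf y)) (fun=> 1) w) => [y Oy|].
- exact: (et_V phi_adm psi_dual k_metric V_neq0 Oy.1).
- by apply: (fam (T := fun y => E y) (dT := dE w)) => // y Oy; exact: el.
Qed.

Lemma jet_chi w a b c : is_derive x w (fun y => Chi y a b c)
  (dchi (K x) (Ph x) (Vf x) (tau x) dV dE dPh w a b c).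
Proof.
have isS p q : is_derive x w (fun y => Ph y (Vf y) p q)
    (dPh w (Vf x) p q + Ph x (dV w) p q).
  apply: (fam (T := fun y u => Ph y u p q) (dT := fun u => dPh w u p q)) => //.
  by move=> y Oy; exact: (alt3_lin (g2_alt (Gy Oy)) p q).
have h := is_deriveB (isPh w a b c) (is_deriveD (is_deriveD
  (is_deriveM (isS a b) (isE w c)) (is_deriveM (isS b c) (isE w a)))
  (is_deriveM (isS c a) (isE w b))).
apply: (is_derive_eq h); rewrite /dchi /sigma_pt -![_ *: _]/(_ * _) /=; ring.
Qed.

Let chiA y (Oy : loc_dom pr i j y) : alternating3 (Chi y).
Proof. by rewrite /= (chiE (Gy Oy)); exact: (hpart_alt (Gy Oy)). Qed.

Let isChiJ w a b c : is_derive x w (fun y => Chi y (Jh y a) b c)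
  (dchi (K x) (Ph x) (Vf x) (tau x) dV dE dPh w (Jh x a) b c
   + Chi x (dJ w a) b c).
Proof.
apply: (fam (T := fun y u => Chi y u b c) (a := fun y => Jh y a)
  (dT := fun u => dchi (K x) (Ph x) (Vf x) (tau x) dV dE dPh w u b c)) => //.
- by move=> y Oy; exact: (alt3_lin (chiA Oy) b c).
- by move=> u; exact: jet_chi.
Qed.

Lemma jet_chiJ w a b c :
  dchi (K x) (Ph x) (Vf x) (tau x) dV dE dPh w (Jh x a) b c
  + Chi x (dJ w a) b c =
  dchi (K x) (Ph x) (Vf x) (tau x) dV dE dPh w a (Jh x b) c
  + Chi x a (dJ w b) c.
Proof.
apply: (@derive_uniq (fun y => Chi y (Jh y a) b c)
  (fun y => Chi y a (Jh y b) c) w) => [y Oy|//|].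
  by rewrite /= (chiE (Gy Oy)); exact: (hpart_acs12 (Gy Oy) (f1y Oy)).
apply: (fam (T := fun y u => Chi y a u c) (a := fun y => Jh y b)
  (dT := fun u => dchi (K x) (Ph x) (Vf x) (tau x) dV dE dPh w a u c)) => //.
- by move=> y Oy; exact: (alt3_lin2 (chiA Oy) a c).
- by move=> u; exact: jet_chi.
Qed.

Let psil y (Oy : loc_dom pr i j y) b c d : lin (fun u => Ps y u b c d).
Proof.
move=> e u v; have G' := Gy Oy.
have Cl : C y (e *: u + v) b = e *: C y u b + C y v b.
  apply: (g2_knondeg G') => z.
  rewrite (linD _ _ (g2_klin G' z)) (linZ _ _ (g2_klin G' z)) !(g2_cross G').
  by rewrite (alt3_lin (g2_alt G')).
by rewrite !(g2_psi G') Cl (alt3_lin (g2_alt G')) !(g2_klin G'); ring.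
Qed.

Lemma jet_psi_chi w a b c :
  dtau w * Ps x (Vf x) a b c + tau x * (dPs w (Vf x) a b c + Ps x (dV w) a b c)
  = dchi (K x) (Ph x) (Vf x) (tau x) dV dE dPh w (Jh x a) b c
  + Chi x (dJ w a) b c.
Proof.
apply: (@derive_uniq (fun y => tau y * Ps y (Vf y) a b c)
  (fun y => Chi y (Jh y a) b c) w) => [y Oy||//].
  exact: (psi_chi (Gy Oy) (t0y Oy) (f1y Oy)).
have isP : is_derive x w (fun y => Ps y (Vf y) a b c)
    (dPs w (Vf x) a b c + Ps x (dV w) a b c).
  apply: (fam (T := fun y u => Ps y u a b c) (dT := fun u => dPs w u a b c)) => //.
  by move=> y Oy; exact: psil.
apply: (is_derive_eq (is_deriveM (istau w) isP)).
by rewrite -![_ *: _]/(_ * _); ring.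
Qed.

Lemma jet_cross a b z :
  dK (Vf x) (C x a b) z + K x (dC a b) z = dPh (Vf x) a b z.
Proof.
apply: (@derive_uniq (fun y => K y (C y a b) z) (fun y => Ph y a b z) (Vf x))
  => [y Oy|].
  exact: (g2_cross (Gy Oy)).
apply: (fam (T := fun y u => K y u z) (a := fun y => C y a b)
  (dT := fun u => dK (Vf x) u z)) => // y Oy.
exact: (g2_klin (Gy Oy)).
Qed.

Lemma jet_psi a b c d : dPs (Vf x) a b c d
  = dPh (Vf x) (C x a b) c d + Ph x (dC a b) c d
    - (dK (Vf x) a c * K x b d + K x a c * dK (Vf x) b d)
    + (dK (Vf x) a d * K x b c + K x a d * dK (Vf x) b c).
Proof.
pose w := Vf x.
apply: (@derive_uniq (fun y => Ps y a b c d) (fun y => Ph y (C y a b) c d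
   - K y a c * K y b d + K y a d * K y b c) w) => [y Oy|].
  exact: (g2_psi (Gy Oy)).
have isP : is_derive x w (fun y => Ph y (C y a b) c d)
    (dPh w (C x a b) c d + Ph x (dC a b) c d).
  apply: (fam (T := fun y u => Ph y u c d) (a := fun y => C y a b)
    (dT := fun u => dPh w u c d)) => // y Oy.
  exact: (alt3_lin (g2_alt (Gy Oy)) c d).
have h := is_deriveD (is_deriveB isP (is_deriveM (isK w a c) (isK w b d)))
  (is_deriveM (isK w a d) (isK w b c)).
by apply: (is_derive_eq h); rewrite -![_ *: _]/(_ * _) /w; ring.
Qed.

Let isDFV w : D2 w (Vf x) + dV w *m DF x = 0.
Proof.
apply/rowP => c; rewrite mxE [RHS]mxE.
apply: (@derive_uniq (fun y => (Vf y *m DF y) 0 c) (fun=> 0) w) => [y Oy|].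
  by rewrite V_jacobian // mxE.
apply: (fam (T := fun y u => (u *m DF y) 0 c) (dT := fun u => D2 w u 0 c)) => //.
- by move=> y Oy e u v; rewrite mulmxDl -scalemxAl !mxE.
- by move=> u; apply: coord.
Qed.

Let D2V a : D2 (Vf x) a = - (dV a *m DF x).
Proof. by apply/eqP; rewrite D2C -addr_eq0 isDFV. Qed.

(** The derivative of [quotientE] along [V]. The components of [kN] and [tau] are constant in this
    direction, so besides [eta] only the second derivative of the projection contributes, and [D2V]
    rewrites it with [dV]. *)
Lemma jet_k a b :
  dK (Vf x) a b + K x (dV a) b + K x a (dV b) =
  (tau x ^+ 2)^-1 * ((dE (Vf x) a + E x (dV a)) * E x b
                     + E x a * (dE (Vf x) b + E x (dV b))).
Proof.
set w := Vf x; pose kq y p q := ev2 (kN j) (F y) p q.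
have kql y (Oy : loc_dom pr i j y) q : lin (fun p => kq y p q).
  exact: (kN_lin Oy).
have kqs y (Oy : loc_dom pr i j y) p q : kq y p q = kq y q p.
  have LK (r : 'rV[R]_6) : r = r *m lift_mx i j y *m DF y.
    by rewrite -mulmxA (lift_mxK Oy) mulmx1.
  rewrite (LK p) (LK q) /kq; set p' := p *m _; set q' := q *m _.
  have := quotientE Oy p' q'; have := quotientE Oy q' p'.
  by rewrite (g2_ksym (Gy Oy) p' q') => -> /eqP; rewrite [E y q' * _]mulrC;
    move=> /eqP /addIr.
have kqr y (Oy : loc_dom pr i j y) p : lin (kq y p).
  by move=> e q r; rewrite !(kqs y Oy p) (kql y Oy).
have isk2 p : is_derive x w (fun y => kq y (a *m DF y) p)
    (dkN w (a *m DF x) p + kq x (D2 w a) p).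
  apply: (fam (T := fun y u => kq y u p) (a := fun y => a *m DF y)
    (dT := fun u => dkN w u p)) => // y Oy.
  exact: kql.
have isk3 : is_derive x w (fun y => kq y (a *m DF y) (b *m DF y))
   (dkN w (a *m DF x) (b *m DF x) + kq x (D2 w a) (b *m DF x)
     + kq x (a *m DF x) (D2 w b)).
  apply: (fam (T := fun y u => kq y (a *m DF y) u) (a := fun y => b *m DF y)
    (dT := fun p => dkN w (a *m DF x) p + kq x (D2 w a) p)) => // y Oy.
  exact: kqr.
have ist2 : is_derive x w (fun y => tau y * tau y) 0.
  by apply: (is_derive_eq (is_deriveM (istau w) (istau w)));
    rewrite dtauV scaler0 addr0.
(* Multiplied by the square of [tau], so that no inverse has to be differentiated. *)
have hq y (Oy : loc_dom pr i j y) : tau y * tau y * K y a b =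
    tau y * tau y * kq y (a *m DF y) (b *m DF y) + E y a * E y b.
  by rewrite (quotientE Oy a b) -/(kq y _ _); have tn := t0y Oy; field.
have := derive_uniq hq (is_deriveM ist2 (isK w a b))
  (is_deriveD (is_deriveM ist2 isk3) (is_deriveM (isE w a) (isE w b))).
rewrite -![_ *: _]/(_ * _) dkNV /w !D2V.
have q1 := quotientE Ox (dV a) b; have q2 := quotientE Ox a (dV b).
rewrite (linN _ (kql x Ox _)) (linN _ (kqr x Ox _)) => e.
have tn := t0y Ox; rewrite q1 q2 -/(kq x _ _) -/(kq x _ _).
apply: (mulfI (mulf_neq0 tn tn)).
transitivity (tau x * tau x * dK (Vf x) a b
   + tau x * tau x * kq x (dV a *m DF x) (b *m DF x)
   + tau x * tau x * kq x (a *m DF x) (dV b *m DF x)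
   + E x (dV a) * E x b + E x a * E x (dV b)); first by field.
transitivity (dE (Vf x) a * E x b + E x (dV a) * E x b
  + E x a * dE (Vf x) b + E x a * E x (dV b)); last by field.
by move: e; rewrite /=; lra.
Qed.

Let V0DF : Vf x *m DF x = 0 := V_jacobian Ox.

Let isDJ w a : D2 w (Jh x a) + dJ w a *m DF x =
  A (w *m DF x) (a *m DF x) + D2 w a *m J j (F x).
Proof.
apply/rowP => c; rewrite mxE [RHS]mxE.
apply: (@derive_uniq (fun y => (Jh y a *m DF y) 0 c)
  (fun y => (a *m DF y *m J j (F y)) 0 c) w) => [y Oy||].
- by rewrite /= (acs_jacobian Oy).
- apply: (fam (T := fun y u => (u *m DF y) 0 c) (a := fun y => Jh y a)
    (dT := fun u => D2 w u 0 c)) => // [y Oy e u v|u]; last by apply: coord.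
  by rewrite mulmxDl -scalemxAl !mxE.
- apply: (fam (T := fun y u => (u *m J j (F y)) 0 c) (a := fun y => a *m DF y)
    (dT := fun u => A (w *m DF x) u 0 c)) => // [y Oy e u v|u]; last by apply: coord.
  by rewrite mulmxDl -scalemxAl !mxE.
Qed.

Let D2N w a : D2 w (- a) = - D2 w a.
Proof.
apply/rowP => c; rewrite [RHS]mxE.
apply: (@derive_uniq (fun y => (- a *m DF y) 0 c) (fun y => - (a *m DF y) 0 c) w)
  => [y Oy||].
- by rewrite mulNmx mxE.
- exact: coord.
- by apply: is_deriveN; exact: coord.
Qed.

Let dE_lin w : lin (dE w).
Proof.
move=> c a b; apply: (derive_uniq _ (isE w (c *: a + b))
  (is_deriveD (is_deriveZ c (isE w a)) (isE w b))) => y Oy.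
exact: el.
Qed.

Let dPh_alt w : alternating3 (dPh w).
Proof.
split=> [b c e u v|a b c|a b c].
- apply: (derive_uniq _ (isPh w (e *: u + v) b c)
    (is_deriveD (is_deriveZ e (isPh w u b c)) (isPh w v b c))) => y Oy.
  exact: (alt3_lin (g2_alt (Gy Oy))).
- apply: (derive_uniq _ (isPh w a b c) (is_deriveN (isPh w b a c))) => y Oy.
  exact: (alt3_12 (g2_alt (Gy Oy))).
- apply: (derive_uniq _ (isPh w a b c) (is_deriveN (isPh w a c b))) => y Oy.
  exact: (alt3_23 (g2_alt (Gy Oy))).
Qed.

Let v_lin b : lin (fun a => K x (dV a) b).
Proof. by move=> e u v; rewrite dV_lin (g2_klin G). Qed.

Let GN := acs_gamma (J j (F x)) A.

(** Lift of the connection on [N]: the term [D2] compensates the second derivative of the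
    projection, which thereby becomes affine. Symmetry comes from [D2C], and the vertical part, left
    to [lift_mx], is invisible to [chi]. *)
Let Gam w a := (GN (w *m DF x) (a *m DF x) - D2 w a) *m lift_mx i j x.

Let GamDF w a : Gam w a *m DF x = GN (w *m DF x) (a *m DF x) - D2 w a.
Proof. by rewrite -mulmxA (lift_mxK Ox) mulmx1. Qed.

Let GamC a b : Gam a b = Gam b a.
Proof. by rewrite /Gam /GN acs_gammaC D2C. Qed.

Let GNN p q : GN p (- q) = - GN p q.
Proof.
have lN r : GN (- r) p = - GN r p.
  have l0 : GN 0 p = 0.
    have := acs_gamma_lin (J j (F x)) A_lin1 A_lin2 1 0 0 p.
    by rewrite !scale1r addr0 => /esym/eqP; rewrite -subr_eq0 addrK => /eqP.
  have := acs_gamma_lin (J j (F x)) A_lin1 A_lin2 (-1) r 0 p.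
  by rewrite -/GN l0 !addr0 !scaleN1r.
by rewrite ![GN p _]acs_gammaC -/GN lN.
Qed.

Let GN0 p : GN p 0 = 0.
Proof.
have := GNN p 0; rewrite oppr0 => /eqP.
by rewrite -addr_eq0 -mulr2n -scaler_nat scaler_eq0 pnatr_eq0 /= => /eqP.
Qed.

Let GamV w : collinear (Vf x) (Gam w (Vf x) - dV w).
Proof.
apply: (vertical Ox); rewrite mulmxBl GamDF V0DF GN0 sub0r.
by rewrite -opprD isDFV oppr0.
Qed.

Let GamJ w a : collinear (Vf x) (dJ w a + Jh x (Gam w a) - Gam w (Jh x a)).
Proof.
apply: (vertical Ox); rewrite mulmxBl mulmxDl GamDF !(acs_jacobian Ox) GamDF.
have -> : dJ w a *m DF x = A (w *m DF x) (a *m DF x) + D2 w a *m J j (F x)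
    - D2 w (Jh x a) by rewrite -isDJ addrC addKr.
rewrite mulmxBl (acs_gammaJ _ A_lin1 A_anticomm A_nijenhuis); last first.
  exact: (acs_sqr_cod (loc_cod Ox)).
rewrite -/GN opprB !addrA.
move: (GN _ _) (GN _ _ *m _) (D2 w a *m _) (D2 w (Jh x a)) => p q r u.
by apply/rowP => c; rewrite !mxE; ring.
Qed.

Let GamN w a : Gam w (- a) = - Gam w a.
Proof. by rewrite /Gam !mulNmx GNN D2N -opprD mulNmx. Qed.

Hypothesis lie_phi : forall a b c,
  dPh (Vf x) a b c + Ph x (dV a) b c + Ph x a (dV b) c + Ph x a b (dV c) = 0.
Hypothesis closed_phi3 : forall a b c d,
  dPh a b c d - dPh b a c d + dPh c a b d - dPh d a b c = 0.
Hypothesis closed_psi4 : forall a b c d,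
  dPs (Vf x) a b c d - dPs a (Vf x) b c d + dPs b (Vf x) a c d
  - dPs c (Vf x) a b d + dPs d (Vf x) a b c = 0.

Lemma lie_eta_chart a : dE (Vf x) a + E x (dV a) = 0.
Proof.
exact: (lie_eta_eq0 G (dim_chart phi_adm k_metric ix) (t0y Ox) (f1y Ox) v_lin dE_lin
  dPh_alt jet_eta lie_phi jet_chiJ GamC GamV GamJ).
Qed.

Lemma contraction_exact_chart Xv a b : E x Xv = 0 ->
  (forall u, Ph x (Vf x) Xv u = - dtau u) ->
  Ph x Xv a b = - (dtau a * E x b - dtau b * E x a) - tau x * (dE a b - dE b a).
Proof.
move=> EX hamX.
exact: (contraction_exact G (dim_chart phi_adm k_metric ix) (t0y Ox) (f1y Ox) v_lin
  dE_lin dE_lin1 dPh_alt jet_eta lie_phi closed_phi3 closed_psi4 jet_k jet_cross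
  jet_psi jet_chiJ jet_psi_chi GamC GamV GamJ GamN EX hamX).
Qed.

(** The bracket projects to zero because the projected field is constant along [V], and [eta]
    vanishes on it because [eta] is invariant and kills the lift; [vertical_eq0] concludes. *)
Lemma lift_commutes (Xf : W -> W) (Uf : 'rV[R]_6 -> 'rV[R]_6) (dX : W -> W) :
  (forall w, is_derive x w Xf (dX w)) ->
  is_derive x (Vf x) (fun y => Uf (F y)) 0 ->
  (forall y, loc_dom pr i j y -> Xf y *m DF y = Uf (F y)) ->
  (forall y, loc_dom pr i j y -> E y (Xf y) = 0) ->
  dV (Xf x) - dX (Vf x) = 0.
Proof.
move=> isX isU Xpr Xhor; apply: (vertical_eq0 Ox).
  have : D2 (Vf x) (Xf x) + dX (Vf x) *m DF x = 0.
    apply/rowP => c; rewrite mxE.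
    have isL : is_derive x (Vf x) (fun y => (Xf y *m DF y) 0 c)
        (D2 (Vf x) (Xf x) 0 c + (dX (Vf x) *m DF x) 0 c).
      apply: (fam (T := fun y u => (u *m DF y) 0 c)
        (dT := fun u => D2 (Vf x) u 0 c)) => // [y Oy e u v|u]; last exact: coord.
      by rewrite mulmxDl -scalemxAl !mxE.
    by apply: (derive_uniq _ isL (coord c isU)) => y Oy; rewrite Xpr.
  by rewrite D2V mulmxBl => /eqP; rewrite addrC subr_eq0 => /eqP ->; rewrite subrr.
have isL : is_derive x (Vf x) (fun y => E y (Xf y))
    (dE (Vf x) (Xf x) + E x (dX (Vf x))).
  by apply: (fam (T := fun y => E y) (dT := dE (Vf x))) => // y Oy; exact: el.
have e1 := derive_uniq Xhor isL (is_derive_cst 0 x (Vf x)).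
by rewrite (linB _ _ (el Ox)); have := lie_eta_chart (Xf x); lra.
Qed.

End Jets.

Hypothesis phi_closed : closed_form phi.
Hypothesis psi_closed : closed_form psi.
Hypothesis V_pres : preserves V phi.
Hypothesis J_int : integrable_acs J.
Variables (U : vfield N) (X : vfield Y).
Hypothesis U_ham : hamiltonian sigma (fun q => - t q) U.
Hypothesis X_lift : is_horizontal_lift V pr k U X.

(** * Instantiation with actual derivatives and conclusion *)

Section Instance.
Variables (i : idx Y) (j : idx N).
Local Notation W := 'rV[R]_7.
Local Notation Om := (loc_dom pr i j).
Local Notation F := (loc pr i j).
Local Notation DF y := (jacobian F y).
Local Notation K := (ev2 (k i)).
Local Notation Ph := (ev3 (phi i)).
Local Notation Ps := (ev4 (psi i)).
Local Notation Vf := (V i).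
Local Notation tau := (tY V k i).
Local Notation C := (crossY phi k i).
Local Notation E := (fun y => eta_pt (K y) (Vf y) (tau y)).
Local Notation Jh := (fun y => C y (tau y *: Vf y)).

Let pr_smooth : smooth_map pr. Proof. by have [] := orb. Qed.
Let Oo : open Om := loc_dom_open pr_smooth (i := i) (j := j).
Let Fs : smooth_on Om F := loc_smooth pr_smooth i j.
Let Oi : Om `<=` cod i. Proof. by move=> y []. Qed.

(** Regularity is pulled back from the smooth function [t] on [N], which avoids differentiating a
    square root. *)
Let tau_Ck n : Ck_on n Om tau.
Proof.
have Ct := Ck_on_comp Oo (fun y Oy => loc_cod Oy) Fs (t_desc.1 j n).
by apply: (Ck_on_eq Oo _ Ct) => y Oy; exact: t_loc.
Qed.

Let K_Ck n a b : Ck_on n Om (fun y => K y a b).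
Proof. exact: Ck_on_sub Oi (tensor_smooth k i (mx2 a b) n). Qed.

Let V_Ck n : Ck_on n Om Vf.
Proof. exact: Ck_on_sub Oi (vfield_smooth V i n). Qed.

Let E_Ck n a : Ck_on n Om (fun y => E y a).
Proof.
have Cs := Ck_onM Oo (Ck_onM Oo (tau_Ck n) (tau_Ck n)) (Ck_on_sum Oo
  (fun c : 'I_7 => Ck_onM Oo (Ck_on_coord c Oo (V_Ck n)) (K_Ck n (delta_mx 0 c) a))).
apply: (Ck_on_eq Oo _ Cs) => y Oy; have G := g2_point_chart phi_adm psi_dual k_metric (Oi Oy).
rewrite /eta_pt expr2 (g2_ksym G a); congr (_ * _).
rewrite [in RHS](row_sum_delta (Vf y)) (big_morph (fun u => K y u a) (id1 := 0) (op1 := +%R)).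
- by apply: eq_bigr => c _; rewrite (linZ _ _ (g2_klin G a)).
- by move=> u v; rewrite (linD _ _ (g2_klin G a)).
- exact: (lin0 (g2_klin G a)).
Qed.

Section At.
Variable x : W.
Hypothesis Ox : Om x.

Let diff_is (f : W -> R) w : differentiable f x -> is_derive x w f ('D_w f x).
Proof. by move=> df; apply/derivableP/diff_derivable. Qed.

Let isV w : is_derive x w Vf ('D_w Vf x).
Proof. by apply/derivableP/diff_derivable; exact: (V_Ck 1%N).1. Qed.

Let istau w : is_derive x w tau ('D_w tau x).
Proof. by apply: diff_is; exact: (tau_Ck 1%N).1. Qed.

Let isK w a b : is_derive x w (fun y => K y a b) ('D_w (fun y => K y a b) x).
Proof. by apply: diff_is; exact: (K_Ck 1%N a b).1. Qed.

Let isPh w a b c :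
  is_derive x w (fun y => Ph y a b c) ('D_w (fun y => Ph y a b c) x).
Proof.
by apply: diff_is; exact: ((tensor_smooth phi i (mx3 a b c) 1%N).1 x (Oi Ox)).
Qed.

Let isPs w a b c d :
  is_derive x w (fun y => Ps y a b c d) ('D_w (fun y => Ps y a b c d) x).
Proof.
by apply: diff_is; exact: ((tensor_smooth psi i (mx4 a b c d) 1%N).1 x (Oi Ox)).
Qed.

Let isE w a : is_derive x w (fun y => E y a) ('D_w (fun y => E y a) x).
Proof. by apply: diff_is; exact: (E_Ck 1%N a).1. Qed.

Let DF_near a : \forall y \near x, 'D_a F y = a *m DF y.
Proof.
by apply: (open_near_eq Oo Ox) => y Oy; rewrite (loc_jacobian pr_smooth).
Qed.

Let isDF w a : is_derive x w (fun y => a *m DF y) ('D_w (fun y => 'D_a F y) x).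
Proof.
apply: (near_eq_is_derive (DF_near a)).
by apply/derivableP/diff_derivable; exact: ((Fs 2%N).2 a).1.
Qed.

Let D2C a b : 'D_a (fun y => 'D_b F y) x = 'D_b (fun y => 'D_a F y) x.
Proof. exact: (smooth_schwarz_row b a Oo Ox Fs). Qed.

Let dF : differentiable F x. Proof. exact: (Fs 1%N).1. Qed.

Let kN_diff B : differentiable (fun z => kN j z B) (F x).
Proof. exact: ((tensor_smooth kN j B 1%N).1 _ (loc_cod Ox)). Qed.

Let iskN w p q : is_derive x w (fun y => ev2 (kN j) (F y) p q)
  ('D_w (fun y => ev2 (kN j) (F y) p q) x).
Proof.
apply: diff_is.
exact: (@differentiable_comp _ _ _ _ F (fun z => kN j z (mx2 p q)) x dF (kN_diff _)).
Qed.

Let DVF : 'D_(Vf x) F x = 0.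
Proof. by rewrite -(loc_jacobian pr_smooth _ Ox) (V_jacobian Ox). Qed.

Let dkNV p q : 'D_(Vf x) (fun y => ev2 (kN j) (F y) p q) x = 0.
Proof.
apply: (etrans (derive_comp (g := fun z => kN j z (mx2 p q)) (Vf x) dF (kN_diff _))).
by rewrite DVF; exact: derive0.
Qed.

Let t_diff : differentiable (fun z => t (param j z)) (F x).
Proof. exact: ((t_desc.1 j 1%N).1 _ (loc_cod Ox)). Qed.

Let tau_near : \forall y \near x, t (param j (F y)) = tau y.
Proof. by apply: (open_near_eq Oo Ox) => y Oy; exact: t_loc. Qed.

Let dtauE w : 'D_w tau x = 'D_(w *m DF x) (fun z => t (param j z)) (F x).
Proof.
rewrite (loc_jacobian pr_smooth _ Ox) -(near_eq_derive w tau_near).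
exact: (derive_comp (g := fun z => t (param j z)) w dF t_diff).
Qed.

Let dtauV : 'D_(Vf x) tau x = 0.
Proof. by rewrite dtauE (V_jacobian Ox); exact: derive0. Qed.

Let J_diff : differentiable (J j) (F x).
Proof. exact: ((endofield_smooth J j 1%N).1 _ (loc_cod Ox)). Qed.

Let isJ w u : is_derive x w (fun y => u *m J j (F y))
  (dacs (J j) (F x) (w *m DF x) u).
Proof.
have dc c : differentiable (fun y => (u *m J j (F y)) 0 c) x.
  exact: (@differentiable_comp _ _ _ _ F (fun z => (u *m J j z) 0 c) x dF
    (mulmx_coord_differentiable J_diff u c)).
have du : derivable (fun y => u *m J j (F y)) x w.
  by apply/derivable_mxP => r c; rewrite ord1; exact: diff_derivable.
apply: (DeriveDef du); rewrite derive_mx //; apply/rowP => c; rewrite mxE.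
rewrite (dacsE J_diff) (loc_jacobian pr_smooth _ Ox).
apply: (etrans (derive_comp (g := fun z => (u *m J j z) 0 c) w dF
  (mulmx_coord_differentiable J_diff u c))).
by rewrite deriveE //; exact: mulmx_coord_differentiable.
Qed.

Let isC (g : W -> W) w b : derivable g x w ->
  is_derive x w (fun y => C y (g y) b) ('D_w (fun y => C y (g y) b) x).
Proof.
move=> dg; apply: derivableP; apply: derivable_mul_invmx => [c|a c|].
- rewrite (_ : (fun y => _) = fun y => Ph y (g y) b (delta_mx 0 c)); last first.
    by apply/funext => y; rewrite mxE.
  have [] // := @is_derive_family R _ 7
    (fun y u => Ph y u b (delta_mx 0 c)) g x w _ _ dg.
    apply: filterS (open_nbhs_nbhs (conj Oo Ox)) => y Oy.
    have G := g2_point_chart phi_adm psi_dual k_metric (Oi Oy).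
    exact: (alt3_lin (g2_alt G) b (delta_mx 0 c)).
  by move=> u; have [] := isPh w u b (delta_mx 0 c).
- rewrite (_ : (fun y => _) = fun y => K y (delta_mx 0 a) (delta_mx 0 c)).
    by have [] := isK w (delta_mx 0 a) (delta_mx 0 c).
  by apply/funext => y; rewrite mxE.
- apply: filterS (open_nbhs_nbhs (conj Oo Ox)) => y Oy.
  exact: (gram_unit_chart phi_adm k_metric (Oi Oy)).
Qed.

Let isC' a b : is_derive x (Vf x) (fun y => C y a b) ('D_(Vf x) (fun y => C y a b) x).
Proof. by apply: (isC (g := fun=> a)); exact: derivable_cst. Qed.

Let isJh w a : is_derive x w (fun y => Jh y a) ('D_w (fun y => Jh y a) x).
Proof.
apply: isC; apply/derivable_mxP => r c; rewrite ord1.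
rewrite (_ : (fun y => _) = fun y => tau y * Vf y 0 c).
  apply: derivableM; first by have [] := istau w.
  by have [/derivable_mxP dv _] := isV w; exact: dv.
by apply/funext => y; rewrite mxE.
Qed.

Let dV_lin e a b : 'D_(e *: a + b) Vf x = e *: 'D_a Vf x + 'D_b Vf x.
Proof.
have dv : differentiable Vf x by exact: (V_Ck 1%N).1.
by rewrite !(deriveE _ dv) linearP.
Qed.

Let dE_lin1 a : lin (fun w => 'D_w (fun y => E y a) x).
Proof.
have de : differentiable (fun y => E y a) x by exact: (E_Ck 1%N a).1.
by move=> e w w'; rewrite !(deriveE _ de) linearP.
Qed.

Let J2near : \forall z \near F x, J j z *m J j z = - 1%:M.
Proof.
have oj : open (cod j) by exact: cod_open.
by apply: filterS (open_nbhs_nbhs (conj oj (loc_cod Ox))) => z jz; exact: acs_sqr_cod.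
Qed.

Let Jint u v : nijenhuis (J j) (F x) u v = 0.
Proof. exact: (J_int _ _ (loc_cod Ox)). Qed.

Let lie_phi a b c : 'D_(Vf x) (fun y => Ph y a b c) x + Ph x ('D_a Vf x) b c
  + Ph x a ('D_b Vf x) c + Ph x a b ('D_c Vf x) = 0.
Proof. by have := V_pres (mx3 a b c) (Oi Ox); rewrite lie_deriv3E. Qed.

Let closed_phi3 a b c d :
  'D_a (fun y => Ph y b c d) x - 'D_b (fun y => Ph y a c d) x
  + 'D_c (fun y => Ph y a b d) x - 'D_d (fun y => Ph y a b c) x = 0.
Proof. by have := phi_closed (mx4 a b c d) (Oi Ox); rewrite ext_d3E. Qed.

Let closed_psi4 a b c d :
  'D_(Vf x) (fun y => Ps y a b c d) x - 'D_a (fun y => Ps y (Vf x) b c d) x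
  + 'D_b (fun y => Ps y (Vf x) a c d) x - 'D_c (fun y => Ps y (Vf x) a b d) x
  + 'D_d (fun y => Ps y (Vf x) a b c) x = 0.
Proof. by have := psi_closed (mx5 (Vf x) a b c d) (Oi Ox); rewrite ext_d4E. Qed.

Let hor_X y : Om y -> E y (X i y) = 0.
Proof.
move=> Oy; rewrite /= -(etaE V phi_adm psi_dual k_metric _ (Oi Oy)).
exact: X_lift.2 (Oi Oy).
Qed.

Let pr_X y : Om y -> X i y *m DF y = U j (F y).
Proof. exact: X_lift.1. Qed.

Let ham_X u : Ph x (Vf x) (X i x) u = - 'D_u tau x.
Proof.
rewrite (sigma_loc Ox) (pr_X Ox) dtauE.
apply: (etrans (U_ham _ (loc_cod Ox))).
have dt : derivable (fun z => t (param j z)) (F x) (u *m DF x).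
  exact: diff_derivable.
exact: (deriveN dt).
Qed.

Let A_lin1 := dacs_lin1 J_diff.
Let A_lin2 := dacs_lin2 J_diff.
Let A_anti := dacs_anticomm J_diff J2near.
Let A_nij := dacs_nijenhuis Jint.

Lemma contraction_exact_at a b : Ph x (X i x) a b =
  - ('D_a tau x * E x b - 'D_b tau x * E x a)
  - tau x * ('D_a (fun y => E y b) x - 'D_b (fun y => E y a) x).
Proof.
exact: (contraction_exact_chart Ox isV istau isK isPh isPs isE isDF iskN isJ isC'
  isJh dV_lin dE_lin1 D2C dkNV dtauV A_lin1 A_lin2 A_anti A_nij lie_phi
  closed_phi3 closed_psi4 a b (hor_X Ox) ham_X).
Qed.

Lemma commuting_at : bracket (X i) Vf x = 0.
Proof.
have isX w : is_derive x w (X i) ('D_w (X i) x).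
  apply/derivableP/diff_derivable.
  exact: ((vfield_smooth X i 1%N).1 x (Oi Ox)).
have dU : differentiable (U j) (F x).
  exact: ((vfield_smooth U j 1%N).1 _ (loc_cod Ox)).
have isU : is_derive x (Vf x) (fun y => U j (F y)) 0.
  apply: DeriveDef.
    by apply: diff_derivable; exact: (@differentiable_comp _ _ _ _ F (U j)).
  apply: (etrans (derive_comp (Vf x) dF dU)).
  by rewrite DVF; exact: derive0.
exact: (lift_commutes Ox isV isPh isE isDF isJ isJh dV_lin D2C A_lin1 A_lin2
  A_anti A_nij lie_phi isX isU pr_X hor_X).
Qed.

End At.

(** The components of [t eta], whose exterior derivative is the opposite of [i_X phi]. *)
Let q b y := tau y * E y b.

Let q_Ck n b : Ck_on n Om (q b).
Proof. exact: Ck_onM Oo (tau_Ck n) (E_Ck n b). Qed.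

Let contraction_q x a b : Om x -> Ph x (X i x) a b = 'D_b (q a) x - 'D_a (q b) x.
Proof.
move=> Ox; have dtau : differentiable tau x by exact: (tau_Ck 1%N).1.
have dE c : differentiable (fun y => E y c) x by exact: (E_Ck 1%N c).1.
have Dq c w : 'D_w (q c) x = tau x * 'D_w (fun y => E y c) x + E x c * 'D_w tau x.
  exact: (deriveM (diff_derivable dtau) (diff_derivable (dE c))).
by rewrite (contraction_exact_at Ox) !Dq; ring.
Qed.

Lemma preserves_at x a b c : Om x -> lie_deriv (X i) (phi i) x (mx3 a b c) = 0.
Proof.
move=> Ox; have G := g2_point_chart phi_adm psi_dual k_metric (Oi Ox).
rewrite lie_deriv3E -!/(ev3 _ _ _ _ _).
pose D u v w := 'D_u (fun y => Ph y (X i x) v w) x.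
pose T u v w := Ph x ('D_u (X i) x) v w.
pose S u v w := 'D_u (fun y => 'D_v (q w) y) x.
(* [d phi = 0] trades the derivative along [X] for derivatives along [a], [b], [c] with [X i x] held
   constant. *)
have closed : 'D_(X i x) (fun y => Ph y a b c) x = D a b c - D b a c + D c a b.
  have := phi_closed (mx4 (X i x) a b c) (Oi Ox); rewrite ext_d3E.
  rewrite -!/(ev3 _ _ _ _ _) -/(D a b c) -/(D b a c) -/(D c a b).
  by move: ('D__ _ x) (D a b c) (D b a c) (D c a b) => ? ? ? ?; lra.
have Ss u v w : S u v w = S v u w by exact: (Ck_schwarz v u Oo Ox (q_Ck 2%N w)).
(* Adding the derivative of [X] gives the full derivative of [i_X phi], a difference of second
   derivatives of [t eta]; in the alternating sum these cancel by [Ss]. *)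
have DT u v w : D u v w + T u v w = S u w v - S u v w.
  have isP : is_derive x u (fun y => Ph y (X i y) v w) (D u v w + T u v w).
    apply: (@is_derive_family R _ 7 (fun y p => Ph y p v w) (X i) x u).
    - apply: filterS (open_nbhs_nbhs (conj Oo Ox)) => y Oy.
      have G' := g2_point_chart phi_adm psi_dual k_metric (Oi Oy).
      exact: (alt3_lin (g2_alt G') v w).
    - move=> p; apply: diff_derivable.
      exact: ((tensor_smooth phi i (mx3 p v w) 1%N).1 x (Oi Ox)).
    - by apply: diff_derivable; exact: ((vfield_smooth X i 1%N).1 x (Oi Ox)).
  have dq p r : derivable (fun y => 'D_p (q r) y) x u.
    by apply: diff_derivable; exact: ((q_Ck 2%N r).2 p).1.
  have isS := is_deriveB (derivableP (dq w v)) (derivableP (dq v w)).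
  have near_q := open_near_eq Oo Ox (fun y => contraction_q v w (x := y)).
  have [_ <-] := isP; have [_ <-] := isS.
  exact: (near_eq_derive u near_q).
have e1 := DT a b c; have e2 := DT b a c; have e3 := DT c a b.
have s1 := Ss a c b; have s2 := Ss a b c; have s3 := Ss b c a.
rewrite closed (alt3_12 (g2_alt G) a) -(alt3_cycle (g2_alt G) ('D_c (X i) x)).
rewrite -/(T a b c) -/(T b a c) -/(T c a b).
move: e1 e2 e3 s1 s2 s3; move: (D a b c) (D b a c) (D c a b) (T a b c) (T b a c) (T c a b).
move: (S a c b) (S a b c) (S b c a) (S b a c) (S c b a) (S c a b) => *.
lra.
Qed.

End Instance.

Lemma preserves_lift : preserves X phi.
Proof.
move=> i x A ix; have [j jx] := dom_cover (pr (param i x)).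
by rewrite (mx3_eta A); apply: (@preserves_at i j); split.
Qed.

Lemma commuting_lift : commuting X V.
Proof.
move=> i x ix; have [j jx] := dom_cover (pr (param i x)).
by apply: (@commuting_at i j); split.
Qed.

End QuotientAcs.

Theorem corollary3 (R : realType) (Y : manifold R 7) (phi : dform Y 3)
    (k : tensor Y 2) (V : vfield Y) (N : manifold R 6) (pr : Y -> N)
    (t : N -> R) (kN : tensor N 2) (sigma : dform N 2) (J : endofield N)
    (U : vfield N) (X : vfield Y) :
  torsion_free_g2 phi ->
  is_g2_metric phi k ->
  nowhere_vanishing V ->
  preserves V phi ->
  is_orbit_space V pr ->
  descends_t V pr k t ->
  is_quotient_metric V pr k kN ->
  descends_sigma V pr phi sigma ->
  is_induced_acs t kN sigma J ->
  integrable_acs J ->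
  hamiltonian sigma (fun q => - t q) U ->
  is_horizontal_lift V pr k U X ->
  preserves X phi /\ commuting X V.
Proof.
move=> [adm cphi [psi dual cpsi]] km V0 Vp orb td kq sd Ji Jint Uh Xl.
split; [exact: (preserves_lift adm dual km V0 orb td kq sd Ji cphi cpsi Vp Jint Uh Xl)
       |exact: (commuting_lift adm dual km V0 orb td kq sd Ji Vp Jint Xl)].
Qed.
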